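(* Let $1\le M\le N$ be integers and let $\{\lambda_1,\dots,\lambda_N\}$ be distributed according to $\mathrm{Gin}(N)$, the eigenvalue point process of the complex Ginibre ensemble. For $1\le k\le M$ let $I_k=\{i\in\{1,\dots,N\} : i\equiv k \pmod M\}$. Then the following equality in distribution of (unordered) random point sets, counted with multiplicity, holds: $$\{\lambda_1^M,\dots,\lambda_N^M\}\stackrel{d}{=}\bigcup_{k=1}^M \mathrm{Gin}(N,M,k),$$ where the $M$ point processes $\mathrm{Gin}(N,M,1),\dots,\mathrm{Gin}(N,M,M)$ on the right-hand side are independent and, for each $k$, $\mathrm{Gin}(N,M,k)$ is the point process of $|I_k|$ complex points $(z_i)_{i\in I_k}$ with joint density $$\frac{1}{Z_{N,M,k}}\prod_{\substack{i<j\\ i,j\in I_k}}|z_i-z_j|^2\prod_{i\in I_k}|z_i|^{\frac{2(k-M)}{M}}e^{-N|z_i|^{2/M}}$$ with respect to Lebesgue measure on $\mathbb{C}^{I_k}$, $Z_{N,M,k}$ being the normalization constant.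
   Context: $\mathrm{Gin}(N)$ denotes the law of the set of eigenvalues of an $N\times N$ matrix with i.i.d. complex Gaussian entries $\mathcal N_{\mathbb C}(0,1/N)$; equivalently, the random set of $N$ complex points whose joint density with respect to Lebesgue measure on $\mathbb{C}^N$ is proportional to $\prod_{1\le i<j\le N}|z_i-z_j|^2\,e^{-N\sum_{i=1}^N|z_i|^2}$. *)

(* Defs.v *)
From HB Require Import structures.
From mathcomp Require Import all_boot all_order all_algebra.
From mathcomp Require Import finmap multiset complex.
From mathcomp Require Import all_classical all_reals all_analysis.

Set Implicit Arguments.
Unset Strict Implicit.
Unset Printing Implicit Defensive.

Import Order.TTheory GRing.Theory Num.Theory.

Local Open Scope classical_set_scope.
Local Open Scope ring_scope.

(* The library norm of z : R[i] is an element of R[i]; this is the modulus in R. *)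
Notation normc := ComplexField.Normc.normc.

Lemma pushforward_sigma_finite d1 d2 (T1 : measurableType d1)
    (T2 : measurableType d2) (R : realType) (mu : set T1 -> \bar R)
    (f : T1 -> T2) (g : T2 -> T1) :
  sigma_finite setT mu -> measurable_fun setT g -> cancel f g ->
  sigma_finite setT (pushforward mu f).
Proof.
move=> [F UF mF] mg fK; exists (fun i => g @^-1` F i).
  by rewrite -preimage_bigcup -UF preimage_setT.
move=> i; have [mFi Foo] := mF i; split.
  by rewrite -[X in measurable X]setTI; exact: mg.
rewrite /pushforward (_ : f @^-1` _ = F i)//.
by apply/seteqP; split => x /=; rewrite fK.
Qed.

(* The instance of the library is shadowed by the one for subprobabilities. *)
Lemma product_sigma_finite d1 d2 (T1 : measurableType d1)
    (T2 : measurableType d2) (R : realType)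
    (m1 : {sigma_finite_measure set T1 -> \bar R})
    (m2 : {sigma_finite_measure set T2 -> \bar R}) :
  sigma_finite setT (m1 \x m2)%E.
Proof.
have /sigma_finiteP[F [TF ndF Foo]] := sigma_finiteT m1.
have /sigma_finiteP[G [TG ndG Goo]] := sigma_finiteT m2.
exists (fun n => F n `*` G n).
  rewrite -setXTT TF TG predeqE => -[x y]; split.
    move=> [/= [n _ Fnx] [k _ Gky]]; exists (maxn n k) => //; split.
    - by move: x Fnx; exact/subsetPset/ndF/leq_maxl.
    - by move: y Gky; exact/subsetPset/ndG/leq_maxr.
  by move=> [n _ []/= ? ?]; split; exists n.
move=> k; have [? ?] := Foo k; have [? ?] := Goo k.
split; first exact: measurableX.
by rewrite product_measure1E// lte_mul_pinfty// ge0_fin_numE.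
Qed.

Section complex_plane.
Context (R : realType).

Definition complex_of_pair (p : measurableTypeR R * measurableTypeR R) : R[i] :=
  (p.1 +i* p.2)%C.
Definition pair_of_complex (z : R[i]) : measurableTypeR R * measurableTypeR R :=
  (complex.Re z, complex.Im z).

Lemma complex_of_pairK : cancel complex_of_pair pair_of_complex.
Proof. by case. Qed.

Lemma pair_of_complexK : cancel pair_of_complex complex_of_pair.
Proof. by case. Qed.

(* Borel sets of C, transported from R * R along (x, y) |-> x + i y. *)
Definition measurable_complex : set (set R[i]) :=
  [set A | measurable (complex_of_pair @^-1` A)].

Let measurable_complex0 : measurable_complex set0.
Proof. by rewrite /measurable_complex/= preimage_set0. Qed.

Let measurable_complexC A : measurable_complex A -> measurable_complex (~` A).
Proof. by rewrite /measurable_complex/= preimage_setC; exact: measurableC. Qed.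

Let measurable_complex_bigcup (F : (set R[i])^nat) :
  (forall i, measurable_complex (F i)) -> measurable_complex (\bigcup_i F i).
Proof.
by move=> mF; rewrite /measurable_complex/= preimage_bigcup;
  exact: bigcupT_measurable.
Qed.

HB.instance Definition _ := isPointed.Build R[i] 0%C.
HB.instance Definition _ := @isMeasurable.Build default_measure_display R[i]
  measurable_complex measurable_complex0 measurable_complexC
  measurable_complex_bigcup.

Lemma measurable_complex_of_pair : measurable_fun setT complex_of_pair.
Proof. by move=> _ A mA; rewrite setTI. Qed.

Lemma measurable_pair_of_complex : measurable_fun setT pair_of_complex.
Proof.
move=> _ A mA; rewrite setTI /measurable/= /measurable_complex/=.
rewrite (_ : _ @^-1` _ = A)//.
by apply/seteqP; split => x /=; rewrite complex_of_pairK.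
Qed.

HB.instance Definition _ := isMeasurableFun.Build _ _ _ _ complex_of_pair
  measurable_complex_of_pair.

Definition lebesgue_complex : set R[i] -> \bar R :=
  pushforward (@lebesgue_measure R \x @lebesgue_measure R)%E complex_of_pair.

Let lebesgue_complex0 : lebesgue_complex set0 = 0%E.
Proof. exact: measure0. Qed.

Let lebesgue_complex_ge0 A : (0 <= lebesgue_complex A)%E.
Proof. exact: measure_ge0. Qed.

Let lebesgue_complex_additive : semi_sigma_additive lebesgue_complex.
Proof. exact: measure_semi_sigma_additive. Qed.

HB.instance Definition _ := isMeasure.Build _ _ _ lebesgue_complex
  lebesgue_complex0 lebesgue_complex_ge0 lebesgue_complex_additive.

Let lebesgue_complex_sigma_finite : sigma_finite setT lebesgue_complex.
Proof.
apply: (pushforward_sigma_finite _ measurable_pair_of_complex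
  complex_of_pairK).
exact: product_sigma_finite.
Qed.

HB.instance Definition _ := @Measure_isSigmaFinite.Build _ _ _
  lebesgue_complex lebesgue_complex_sigma_finite.

End complex_plane.

Section tuple_product_measure.
Context d (T : measurableType d) (R : realType).

Definition cons_pair n (p : T * n.-tuple T) : n.+1.-tuple T :=
  [tuple of p.1 :: p.2].
Definition uncons_pair n (t : n.+1.-tuple T) : T * n.-tuple T :=
  (thead t, [tuple of behead t]).

Lemma cons_pairK n : cancel (@cons_pair n) (@uncons_pair n).
Proof.
case=> x t; rewrite /uncons_pair /cons_pair /= theadE.
by congr pair; exact/val_inj.
Qed.

Lemma measurable_cons_pair n : measurable_fun setT (@cons_pair n).
Proof. by apply: measurable_cons. Qed.

Lemma measurable_uncons_pair n : measurable_fun setT (@uncons_pair n).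
Proof.
apply/measurable_fun_pairP; split => /=.
  exact: (measurable_tnth ord0).
exact: measurable_behead.
Qed.

HB.instance Definition _ n := isMeasurableFun.Build _ _ _ _ (@cons_pair n)
  (@measurable_cons_pair n).

Section cons.
Context n (m1 : {sigma_finite_measure set T -> \bar R})
  (m2 : {sigma_finite_measure set (n.-tuple T) -> \bar R}).

Definition cons_measure : set (n.+1.-tuple T) -> \bar R :=
  pushforward (m1 \x m2)%E (@cons_pair n).

Let cons_measure0 : cons_measure set0 = 0%E.
Proof. exact: measure0. Qed.

Let cons_measure_ge0 A : (0 <= cons_measure A)%E.
Proof. exact: measure_ge0. Qed.

Let cons_measure_additive : semi_sigma_additive cons_measure.
Proof. exact: measure_semi_sigma_additive. Qed.

HB.instance Definition _ := isMeasure.Build _ _ _ cons_measure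
  cons_measure0 cons_measure_ge0 cons_measure_additive.

Let cons_measure_sigma_finite : sigma_finite setT cons_measure.
Proof.
apply: (pushforward_sigma_finite _ (@measurable_uncons_pair n)
  (@cons_pairK n)).
exact: product_sigma_finite.
Qed.

HB.instance Definition _ := @Measure_isSigmaFinite.Build _ _ _
  cons_measure cons_measure_sigma_finite.

End cons.

Fixpoint tuple_measure (mu : {sigma_finite_measure set T -> \bar R}) n :
    {sigma_finite_measure set (n.-tuple T) -> \bar R} :=
  match n with
  | 0 => \d_ [tuple]
  | n'.+1 => cons_measure mu (tuple_measure mu n')
  end.

End tuple_product_measure.

(* Finite point configurations, counted with multiplicity; the sigma-algebra
   is the one generated by the counting maps s |-> #(s in B), B measurable. *)
Section configurations.
Context d (T : measurableType d).

Definition config : Type := {mset T}%mset.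

HB.instance Definition _ := Choice.copy config {mset T}%mset.
HB.instance Definition _ := isPointed.Build config mset0.

Definition points_in (B : set T) (s : config) : nat :=
  count (mem B) (enum_mset s).

Definition counting_events : set (set config) :=
  [set E | exists2 B : set T, measurable B &
           exists n : nat, E = [set s | points_in B s = n]].

HB.instance Definition _ := @isMeasurable.Build (sigma_display counting_events)
  config <<s counting_events >> (@sigma_algebra0 _ setT _) (@sigma_algebraC _ _)
  (@sigma_algebra_bigcup _ setT _).

End configurations.

Section point_processes.
Context (R : realType).

Definition normalization n (f : n.-tuple R[i] -> R) : \bar R :=
  (\int[tuple_measure (@lebesgue_complex R) n]_z (f z)%:E)%E.

(* Law of the unordered configuration {z_1, ..., z_n} when (z_1, ..., z_n) has
   joint density f / normalization f w.r.t. Lebesgue measure on C^n. *)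
Definition unordered_law n (f : n.-tuple R[i] -> R) :
    set (config R[i]) -> \bar R := fun E =>
  ((fine (normalization f))^-1%:E *
   \int[tuple_measure (@lebesgue_complex R) n]_(z in
     [set z : n.-tuple R[i] | E (seq_mset z)]) (f z)%:E)%E.

Definition sq_vandermonde n (z : n.-tuple R[i]) : R :=
  \prod_(i < n) \prod_(j < n | (i < j)%N) normc (tnth z i - tnth z j) ^+ 2.

Definition gin_density (N : nat) (z : N.-tuple R[i]) : R :=
  sq_vandermonde z * expR (- (N%:R * \sum_(i < N) normc (tnth z i) ^+ 2)).

Definition Gin (N : nat) : set (config R[i]) -> \bar R :=
  unordered_law (@gin_density N).

(* The ordinal i : 'I_N stands for the index i + 1 of {1, ..., N}. *)
Definition residue_class (N M k : nat) : {set 'I_N} :=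
  [set i : 'I_N | i.+1 == k %[mod M]]%SET.

(* The points are listed along residue_class N M k in increasing order; the
   density depends on this index set only through its cardinality n.
   At 0, powR gives 0 `^ a = 0 for a < 0; this concerns a null set only. *)
Definition gin_power_density (N M k n : nat) (z : n.-tuple R[i]) : R :=
  sq_vandermonde z *
  \prod_(i < n) (normc (tnth z i) `^ (2 * (k%:R - M%:R) / M%:R) *
                 expR (- (N%:R * normc (tnth z i) `^ (2 / M%:R)))).

Definition Gin_power (N M k : nat) : set (config R[i]) -> \bar R :=
  unordered_law (@gin_power_density N M k #|residue_class N M k|).

End point_processes.

Definition mutually_independent d d' (T : measurableType d)
    (T' : measurableType d') (R : realType) (P : probability T R)
    (I : finType) (X : I -> {RV P >-> T'}) : Prop :=
  forall (J : {set I}) (A : I -> set T'),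
    (forall i, i \in J -> measurable (A i)) ->
    P (\bigcap_(i in [set` J]) X i @^-1` A i) =
    (\prod_(i in J) P (X i @^-1` A i))%E.

Definition has_law d d' (T : measurableType d) (T' : measurableType d')
    (R : realType) (P : probability T R) (X : T -> T')
    (mu : set T' -> \bar R) : Prop :=
  forall E : set T', measurable E -> P (X @^-1` E) = mu E.

Definition eq_in_law d1 d2 d' (T1 : measurableType d1)
    (T2 : measurableType d2) (T' : measurableType d') (R : realType)
    (P1 : probability T1 R) (X1 : T1 -> T')
    (P2 : probability T2 R) (X2 : T2 -> T') : Prop :=
  forall E : set T', measurable E -> P1 (X1 @^-1` E) = P2 (X2 @^-1` E).

Definition power_config (R : realType) (M : nat) (s : config R[i]) :
    config R[i] := seq_mset [seq x ^+ M | x <- enum_mset s].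

Definition union_config (R : realType) (I : finType) (s : I -> config R[i]) :
    config R[i] := \big[msetD/mset0]_(i : I) s i.

(* Main.v *)
Require Import Defs.
From HB Require Import structures.
From mathcomp Require Import all_boot all_order all_algebra fingroup perm.
From mathcomp Require Import finmap multiset complex.
From mathcomp Require Import all_classical all_reals all_analysis.
From mathcomp Require Import unstable measurable_realfun ring lra zify.

(** Both sides are compared through their counting statistics: it suffices that
    the sum [X] of [c z] over the points [z] has the same law on both sides, for
    a bounded measurable [c : C -> nat], since by a choice of [c] in base [D] the
    number [X] encodes the numbers of points in finitely many Borel sets
    (a pi-system).  The law of [X] is read off its generating function
    [E t^X = E \prod_i t^(c z_i)].

    By Andreief's identity, the integral of [|Vandermonde|^2 \prod_i h(z_i)] is
    [n! \det (m_ij)] with moments [m_ij = \int z^i conj(z)^j h(z) dz].  For the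
    powers of the Ginibre points, [h(z) = t^(c(z^M)) e^(-N|z|^2)] is invariant
    under rotation by [2 pi / M], hence [m_ij = 0] unless [i = j] modulo [M] and
    the determinant is a product over residue classes.  The substitution
    [w = z^M], which is [M]-to-one with Jacobian [M^2 |z|^(2M-2)], turns the
    moments of the class of [k] into those of the density of [Gin_power N M k],
    and Andreief's identity, read backwards, gives the product of the generating
    functions of the independent processes on the right-hand side.  The
    normalization constants are finite and nonzero because the laws are those of
    random variables. *)

Set Implicit Arguments.
Unset Strict Implicit.
Unset Printing Implicit Defensive.

Import Order.TTheory GRing.Theory Num.Theory numFieldNormedType.Exports.

Local Open Scope classical_set_scope.
Local Open Scope ring_scope.

(** * Change of variables on the line and in the plane *)

(** On configurations with a fixed number of points the statistic is bounded, so its generating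
    function is a polynomial, determined by its values at [1, 2, 3, ...]. At such [t] one has
    [t >= 1], so [t^c] is a bounded weight and every moment against the Gaussian is finite. The
    constants [n!] and [M^n] produced by Andreief's identity and by the substitution are the same
    for every weight. The factorization over residue classes is therefore proved for an arbitrary
    bounded nonnegative [g] and used twice, for [g = t^c] and for [g = 1]; the quotient cancels the
    constants, and no normalization constant is ever evaluated. An expansion in base [D] is
    injective only on digits below [D]. Decoding the counts thus rests on both configurations having
    exactly [N] points almost surely, which is established separately on each side. The permutation
    expansion of the determinants has complex terms, so finiteness must accompany every integral:
    this is the purpose of the relations [has_integral] and [has_cintegral]. *)

Section density.
Local Open Scope ereal_scope.
Context d (T : measurableType d) (R : realType).
Variables (mu : {measure set T -> \bar R}) (g : T -> R).
Hypotheses (mg : measurable_fun setT g) (g0 : forall x, (0 <= g x)%R).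
Variable nu : {measure set T -> \bar R}.
Hypothesis nuE : forall A, measurable A -> nu A = \int[mu]_(x in A) (g x)%:E.

Import HBNNSimple.

(** For indicators this is [nuE]; linearity extends it to simple functions, and monotone convergence
    along [nnsfun_approx] to all nonnegative [f]. *)
Lemma ge0_integral_density (f : T -> \bar R) :
  measurable_fun setT f -> (forall x, 0 <= f x) ->
  \int[nu]_x f x = \int[mu]_x (f x * (g x)%:E).
Proof.
move=> mf f0; pose f_ := nnsfun_approx measurableT mf.
have cvgf x : (f_ n x)%:E @[n --> \oo] --> f x by exact: cvg_nnsfun_approx.
have ndf x : {homo (fun n => (f_ n x)%:E) : n m / (n <= m)%N >-> n <= m}.
  by move=> m n mn; rewrite lee_fin; exact/lefP/nd_nnsfun_approx.
have mEg : measurable_fun setT (EFin \o g) by exact/measurable_EFinP.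
transitivity (limn (fun n => \int[nu]_x (f_ n x)%:E)).
  rewrite -monotone_convergence//.
  - by apply: eq_integral => x _; apply/esym/cvg_lim.
  - by move=> n; exact/measurable_EFinP/measurable_funTS.
  - by move=> *; rewrite lee_fin.
transitivity (limn (fun n => \int[mu]_x ((f_ n x)%:E * (g x)%:E))); last first.
  rewrite -monotone_convergence//.
  - by apply: eq_integral => x _; apply/cvg_lim => //; exact: cvgeZr.
  - move=> n; apply: emeasurable_funM => //.
    exact/measurable_EFinP/measurable_funTS.
  - by move=> *; rewrite mule_ge0// lee_fin.
  - by move=> x _ m n mn; rewrite lee_wpmul2r ?lee_fin// -lee_fin ndf.
apply/congr_lim/funext => n.
have mfn r : measurable (f_ n @^-1` [set r]) by exact: measurable_sfunP.
under eq_integral do rewrite fimfunE -fsumEFin//.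
rewrite ge0_integral_fsum//; last 2 first.
- by move=> r; exact/measurable_EFinP/measurable_funM.
- by move=> r x _; rewrite nnfun_muleindic_ge0.
transitivity (\int[mu]_x (\sum_(r \in range (f_ n))
    ((r * \1_(f_ n @^-1` [set r]) x)%:E * (g x)%:E))); last first.
  apply: eq_integral => x _; rewrite -ge0_mule_fsuml ?fsumEFin -?fimfunE//.
  by move=> r; rewrite nnfun_muleindic_ge0.
rewrite ge0_integral_fsum//; last 2 first.
- move=> r; apply: emeasurable_funM => //.
  by exact/measurable_EFinP/measurable_funM.
- by move=> r x _; rewrite mule_ge0 ?EFinM ?nnfun_muleindic_ge0 ?lee_fin.
apply: eq_fsbigr => r _.
rewrite integralZl_indic_nnsfun// integral_indic//= setIT nuE//.
have [r0|r0] := leP 0%R r; last first.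
  rewrite preimage_nnfun0// integral_set0 mule0 integral0_eq// => x _.
  by rewrite indic0 mulr0 mul0e.
rewrite integral_mkcond -ge0_integralZl//; last 2 first.
- exact/(measurable_restrict _ _ _).1/measurable_funTS.
- by move=> x _; rewrite patchE; case: ifPn; rewrite ?lee_fin.
apply: eq_integral => x _; rewrite patchE indicE EFinM -muleA; congr (_ * _).
by case: ifPn => _; rewrite ?mul1e ?mul0e.
Qed.

End density.

Section substitution.
Local Open Scope ereal_scope.
Context (R : realType).
Local Notation mu := (@lebesgue_measure R).
Variables (F g : R -> R) (D J : set R).
Hypotheses (mF : measurable_fun setT F) (mg : measurable_fun setT g).
Hypothesis g0 : forall x, D x -> (0 <= g x)%R.
Hypotheses (mD : measurable D) (mJ : measurable J).
Hypothesis FJ : forall x, D x -> J (F x).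
Hypothesis FE : forall a b : R, (a < b)%R ->
  mu (`]a, b] `&` J) = \int[mu]_(x in D `&` F @^-1` `]a, b]) (g x)%:E.

(** Extension of [g] by 0, because a density has to be nonnegative on the whole line while the sign
    of [g] is known on [D] only. *)
Let gD := fun x => if x \in D then g x else 0%R.

Let mgD : measurable_fun setT gD.
Proof.
rewrite (_ : gD = g \_ D); last by apply/funext => x; rewrite patchE.
by apply/(measurable_restrict _ _ _).1 => //; exact: measurable_funTS.
Qed.

Let gD0 x : (0 <= gD x)%R.
Proof. by rewrite /gD; case: ifPn => // /set_mem/g0. Qed.

Let dens A := \int[mu]_(x in A) (gD x)%:E.

Let dens0 : dens set0 = 0. Proof. exact: integral_set0. Qed.
Let dens_ge0 A : 0 <= dens A.
Proof. by apply: integral_ge0 => x _; rewrite lee_fin. Qed.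
Let dens_additive : semi_sigma_additive dens.
Proof.
apply: semi_sigma_additive_nng_induced.
  exact/measurable_EFinP.
by move=> x; rewrite lee_fin.
Qed.

HB.instance Definition _ := isMeasure.Build _ (measurableTypeR R) R
  dens dens0 dens_ge0 dens_additive.

Let densE A : measurable A -> dens A = \int[mu]_(x in D `&` A) (g x)%:E.
Proof.
move=> mA; rewrite /dens setIC integral_mkcond integral_mkcondr//.
rewrite [RHS]integral_mkcond; apply: eq_integral => x _.
by rewrite !patchE /gD; case: ifPn => //; case: ifPn.
Qed.

Let nuE (A : set R) : measurable A ->
  mrestr mu mJ A = pushforward dens (F : _ -> measurableTypeR R) A.
Proof.
have oc k : ocitv (`](- k%:R)%R, k%:R]%classic : set R) by exact: is_ocitv.
apply: (@measure_unique _ R (measurableTypeR R) (@ocitv R)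
  (fun k => `](- k%:R)%R, k%:R]%classic) erefl (@ocitvI R) oc _
  (mrestr mu mJ) (pushforward dens (F : _ -> measurableTypeR R))).
- apply/seteqP; split=> x // _; exists (Num.bound x) => //=.
  by rewrite in_itv/= ltrNl ltrNbound ltW// ltr_bound.
- move=> X [[a b] _ <-]/=; rewrite /mrestr /pushforward densE; last first.
    by rewrite -[X in measurable X]setTI; exact: mF.
  have [ab|ba] := ltP a b; first exact: FE.
  rewrite set_itv_ge ?bnd_simp -?leNgt// preimage_set0 setI0 set0I.
  by rewrite measure0 integral_set0.
- move=> k; rewrite (le_lt_trans (measureIl _ _ _))//.
  by rewrite /= lebesgue_measure_itv/=; case: ifPn => // _; rewrite -EFinD ltry.
Qed.

(** Hypothesis [FE] says that Lebesgue measure on [J] and the image under [F] of the density [g] on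
    [D] agree on half-open intervals. These form a generating pi-system, so the two measures
    coincide. Each instance below then has to verify only [FE], an explicit measure or an
    application of the fundamental theorem of calculus. *)
Lemma ge0_integral_subst (f : R -> \bar R) :
  measurable_fun setT f -> (forall x, 0 <= f x) ->
  \int[mu]_(x in J) f x = \int[mu]_(x in D) (f (F x) * (g x)%:E).
Proof.
move=> mf f0.
have indJ x : f x * (\1_J x)%:E = (f \_ J) x.
  by rewrite patchE indicE; case: ifPn; rewrite ?mule1 ?mule0.
transitivity (\int[mrestr mu mJ]_x f x).
  rewrite integral_mkcond; under eq_integral do rewrite -indJ.
  apply/esym/ge0_integral_density => //= A mA.
  by rewrite integral_indic// setIC.
transitivity (\int[pushforward dens (F : _ -> measurableTypeR R)]_x f x).
  by apply: eq_measure_integral => A mA _; exact: nuE.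
rewrite ge0_integral_pushforward//= preimage_setT.
transitivity (\int[mu]_x (f (F x) * (gD x)%:E)).
  by apply: ge0_integral_density => //=; exact: measurableT_comp.
rewrite [RHS]integral_mkcond; apply: eq_integral => x _.
by rewrite patchE /gD; case: ifPn; rewrite ?mule0.
Qed.

End substitution.

Lemma continuous_mulX (R : realType) (c : R) n :
  continuous (fun x : R => c * x ^+ n).
Proof.
by move=> x; apply: cvgM; [exact: cvg_cst|exact: exprn_continuous].
Qed.

Section substitution_instances.
Local Open Scope ereal_scope.
Context (R : realType).
Local Notation mu := (@lebesgue_measure R).
Implicit Type f : R -> \bar R.

Lemma integral_FTC2_oc (F g : R -> R) (a b : R) : (a < b)%R ->
  (forall x, x \in `[a, b] -> is_derive x (1%R : R) F (g x)) ->
  {in `[a, b], continuous g} ->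
  \int[mu]_(x in `]a, b]) (g x)%:E = (F b - F a)%:E.
Proof.
move=> ab Fg cg.
have cF x : x \in `[a, b] -> {for x, continuous F}.
  by move=> /Fg[dF _]; exact/differentiable_continuous/derivable1_diffP.
have cgw : {within `[a, b], continuous g}.
  by apply: continuous_in_subspaceT => x /set_mem/cg.
rewrite integral_itv_obnd_cbnd; last first.
  apply/measurable_EFinP.
  apply: (@measurable_funS _ _ _ _ `[a, b]%classic) => //.
    exact: subset_itv_oc_cc.
  exact: subspace_continuous_measurable_fun.
rewrite (@continuous_FTC2 _ g F) ?EFinB//.
- split=> [x xab| |].
  + by have /Fg[] : x \in `[a, b] by exact: subset_itv_oo_cc.
  + by apply/cvg_at_right_filter/cF; rewrite bound_itvE ltW.
  + by apply/cvg_at_left_filter/cF; rewrite bound_itvE ltW.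
- move=> x xab; rewrite derive1E.
  by have /Fg/@derive_val : x \in `[a, b] by exact: subset_itv_oo_cc.
Qed.

Lemma ge0_integral_affine f (a b : R) : (0 < a)%R ->
  measurable_fun setT f -> (forall x, 0 <= f x) ->
  \int[mu]_x f x = \int[mu]_x (f (a * x + b)%R * a%:E).
Proof.
move=> a0 mf f0.
apply: (@ge0_integral_subst _ (fun x => a * x + b)%R (cst a) setT setT) => //.
- by apply: measurable_funD => //; apply: measurable_funM => //.
- by move=> *; exact: ltW.
- move=> c d cd; rewrite setIT setTI.
  rewrite (_ : _ @^-1` _ = `](c - b) / a, (d - b) / a]%classic)%R.
    rewrite (@integral_cst _ _ _ mu _ _ a%:E)//= !lebesgue_measure_itv/= !lte_fin cd.
    rewrite ltr_pM2r ?invr_gt0// ltrD2r cd -!EFinB -EFinM.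
    by congr EFin; field; exact: lt0r_neq0.
  apply/seteqP; split => x/=; rewrite !in_itv/= ltr_pdivrMr// ler_pdivlMr//.
    by rewrite ltrBlDr lerBrDr (mulrC x).
  by rewrite ltrBlDr lerBrDr (mulrC x).
Qed.

Lemma ge0_integral_affine_set f (J : set R) (a b : R) : (0 < a)%R ->
  measurable J -> measurable_fun setT f -> (forall x, 0 <= f x) ->
  \int[mu]_(x in J) f x =
  \int[mu]_(x in (fun x => a * x + b)%R @^-1` J) (f (a * x + b)%R * a%:E).
Proof.
move=> a0 mJ mf f0; rewrite integral_mkcond (ge0_integral_affine b a0).
- rewrite [RHS]integral_mkcond; apply: eq_integral => x _; rewrite !patchE.
  have -> : (x \in (fun x => (a * x + b)%R) @^-1` J) = ((a * x + b)%R \in J).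
    by apply/idP/idP => /set_mem ?; exact/mem_set.
  by case: ifPn; rewrite ?mul0e.
- by apply/(measurable_restrictT _ _).1 => //; exact: measurable_funTS.
- by move=> x; rewrite patchE; case: ifPn.
Qed.

Lemma ge0_integral_exprn f n : (0 < n)%N ->
  measurable_fun setT f -> (forall x, 0 <= f x) ->
  \int[mu]_(x in `]0%R, +oo[) f x =
  \int[mu]_(x in `]0%R, +oo[) (f (x ^+ n)%R * (n%:R * x ^+ n.-1)%:E).
Proof.
move=> n0 mf f0.
apply: (@ge0_integral_subst _ (fun x => x ^+ n)%R
  (fun x => n%:R * x ^+ n.-1)%R `]0%R, +oo[%classic `]0%R, +oo[%classic) => //.
- by apply: measurable_funM => //; exact: measurable_funX.
- by move=> x /=; rewrite in_itv/= andbT => x0; rewrite mulr_ge0// exprn_ge0// ltW.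
- move=> a b ab.
  (* The [n]-th root, truncated at 0 because [a] and [b] may be negative: the preimage of []a, b]]
     in the half-line is []r a, r b]], which is empty when [b <= 0]. *)
  pose r (c : R) := (Num.max c 0 `^ n%:R^-1)%R.
  have rK c : (r c ^+ n = Num.max c 0)%R.
    rewrite -powR_mulrn ?powR_ge0// -powRrM mulVf ?pnatr_eq0 -?lt0n//.
    by rewrite powRr1// le_max lexx orbT.
  have r0 c : (0 <= r c)%R by exact: powR_ge0.
  have rlt c x : (0 <= x)%R -> (r c < x)%R = (Num.max c 0 < x ^+ n)%R.
    by move=> x0; rewrite -rK ltr_pXn2r// nnegrE.
  have rle c x : (0 <= x)%R -> (x <= r c)%R = (x ^+ n <= Num.max c 0)%R.
    by move=> x0; rewrite -rK ler_pXn2r// nnegrE.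
  have -> : `]a, b] `&` `]0%R, +oo[ = `]Num.max a 0%R, Num.max b 0%R]%classic :> set R.
    apply/seteqP; split => x /=; rewrite !in_itv/= ?andbT gt_max le_max.
      by move=> [/andP[-> ->] ->].
    by move=> /andP[/andP[-> x0]]; rewrite [(x <= 0)%R]leNgt x0 orbF => ->.
  have -> : `]0%R, +oo[ `&` (fun x : R => x ^+ n)%R @^-1` `]a, b] =
      `]r a, r b]%classic :> set R.
    apply/seteqP; split => x /=; rewrite !in_itv/= ?andbT.
      move=> [x0 /andP[ax xb]]; have x0' := ltW x0.
      by rewrite rlt// rle// gt_max ax exprn_gt0// le_max xb.
    move=> /andP[rax xrb]; have x0 : (0 < x)%R by exact: le_lt_trans rax.
    have x0' := ltW x0.
    split=> //; move: rax xrb; rewrite rlt// gt_max => /andP[-> _]/=.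
    by rewrite rle// le_max [(_ <= 0)%R]leNgt exprn_gt0// orbF.
  have [rab|rba] := ltP (r a) (r b).
    transitivity ((r b ^+ n - r a ^+ n)%:E).
      rewrite !rK lebesgue_measure_itv/= lte_fin -EFinB ifT//.
      by rewrite -!rK ltr_pXn2r// nnegrE.
    apply/esym/(@integral_FTC2_oc (fun x => x ^+ n)%R
      (fun x => n%:R * x ^+ n.-1)%R) => // [x _|x _].
      have := @is_deriveX R R id n x (1%R : R) 1%R (is_derive_id _ _).
      by rewrite exprfctE /GRing.scale/= mulr1.
    exact: continuous_mulX.
  have -> : `]r a, r b]%classic = set0 :> set R.
    by rewrite set_itv_ge// bnd_simp -leNgt.
  rewrite integral_set0.
  by rewrite set_itv_ge ?measure0// bnd_simp -leNgt -!rK lerXn2r// nnegrE.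
Qed.

(* [sin x * cos x `^ (-1)] is [tan x] on the interval of integration, where
   [cos] is positive. *)
Lemma ge0_integral_tan f :
  measurable_fun setT f -> (forall x, 0 <= f x) ->
  \int[mu]_x f x =
  \int[mu]_(x in `](- (pi / 2))%R, (pi / 2)%R[)
    (f (sin x * cos x `^ (-1))%R * (cos x ^+ 2)^-1%:E).
Proof.
move=> mf f0.
have mcos : measurable_fun setT (@cos R) 
  by apply: continuous_measurable_fun; exact: continuous_cos.
have msin : measurable_fun setT (@sin R) 
  by apply: continuous_measurable_fun; exact: continuous_sin.
have itvcos (x : R) : x \in `](- (pi / 2))%R, (pi / 2)%R[ -> (0 < cos x)%R.
  by rewrite in_itv/= => xpi; exact: cos_gt0_pihalf.
have tanE (x : R) : x \in `](- (pi / 2))%R, (pi / 2)%R[ ->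
    (sin x * cos x `^ (-1))%R = tan x.
  by move=> /itvcos c0; rewrite powR_inv1// ltW.
have powE (x : R) : x \in `](- (pi / 2))%R, (pi / 2)%R[ ->
    (cos x `^ (-2))%R = (cos x ^+ 2)^-1%R.
  by move=> /itvcos c0; rewrite powRN powR_mulrn ?ltW.
rewrite (@ge0_integral_subst _ (fun x => sin x * cos x `^ (-1))%R
  (fun x => cos x `^ (-2))%R `](- (pi / 2))%R, (pi / 2)%R[%classic setT) => //.
- by apply: eq_integral => x /set_mem xpi; rewrite powE.
- apply: measurable_funM => //.
  by apply: (measurableT_comp (measurable_powR _)).
- by apply: (measurableT_comp (measurable_powR _)).
- by move=> x _; exact: powR_ge0.
- move=> a b ab; rewrite setIT.
  have -> : `](- (pi / 2))%R, (pi / 2)%R[ `&`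
      (fun x : R => sin x * cos x `^ (-1))%R @^-1` `]a, b] =
     `]atan a, atan b]%classic.
    have atani (c : R) : atan c \in `](- (pi / 2))%R, (pi / 2)%R[.
      by rewrite in_itv/= atan_gtNpi2 atan_ltpi2.
    apply/seteqP; split => x /=.
      move=> [xi]; rewrite tanE// !in_itv/= -{1}(atanK a) -{1}(atanK b).
      by rewrite ltr_tan// leNgt ltr_tan// -leNgt.
    rewrite in_itv/= => /andP[ax xb].
    have xi : x \in `](- (pi / 2))%R, (pi / 2)%R[.
      rewrite in_itv/= (lt_trans (atan_gtNpi2 a) ax).
      exact: le_lt_trans xb (atan_ltpi2 b).
    split=> //; rewrite tanE// in_itv/= -(atanK a) -(atanK b).
    by rewrite ltr_tan// leNgt ltr_tan// -leNgt ax.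
  have sub x : x \in `[atan a, atan b] -> x \in `](- (pi / 2))%R, (pi / 2)%R[.
    rewrite !in_itv/= => /andP[ax xb]; rewrite (lt_le_trans (atan_gtNpi2 a) ax).
    exact: le_lt_trans xb (atan_ltpi2 b).
  transitivity ((tan (atan b) - tan (atan a))%:E).
    by rewrite !atanK lebesgue_measure_itv/= lte_fin ab -EFinB.
  transitivity (\int[mu]_(x in `]atan a, atan b]) ((cos x)^-2)%:E).
    apply/esym/(@integral_FTC2_oc (@tan R) (fun x => (cos x)^-2)%R) => //; first exact: lt_atan.
    - by move=> x /sub/itvcos c0; apply: is_derive_tan; exact: lt0r_neq0.
    - move=> x /sub/itvcos c0.
      apply: (@cvgV _ _ (nbhs x) _ (fun x => cos x ^+ 2)%R).
        by rewrite expf_neq0// lt0r_neq0.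
      by apply: cvgM; exact: continuous_cos.
  apply: eq_integral => x /set_mem /subset_itv_oc_cc/= xi.
  by rewrite powE// sub.
Qed.

End substitution_instances.

(** * Iterated integrals and integrals of periodic functions *)

Section iterated.
Local Open Scope ereal_scope.
Context d1 d2 (T1 : measurableType d1) (T2 : measurableType d2) (R : realType).
Variables (m1 : {sigma_finite_measure set T1 -> \bar R})
  (m2 : {sigma_finite_measure set T2 -> \bar R}) (f : T1 * T2 -> \bar R).
Hypotheses (mf : measurable_fun setT f) (f0 : forall p, 0 <= f p).

Lemma measurable_integral_snd (D2 : set T2) : measurable D2 ->
  measurable_fun setT (fun x => \int[m2]_(y in D2) f (x, y)).
Proof.
move=> mD; pose g := f \_ (snd @^-1` D2).
rewrite (_ : (fun x => _) = fubini_F m2 g).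
  apply: measurable_fun_fubini_tonelli_F.
    apply/(measurable_restrictT _ _).1; last exact: measurable_funTS.
    by rewrite -[X in measurable X]setTI; exact: measurable_snd.
  by move=> p; rewrite /g patchE; case: ifPn.
apply/funext => x; rewrite integral_mkcond; apply: eq_integral => y _.
by rewrite /g !patchE; congr (if _ then _ else _).
Qed.

Lemma integral_swap (D1 : set T1) (D2 : set T2) :
  measurable D1 -> measurable D2 ->
  \int[m1]_(x in D1) \int[m2]_(y in D2) f (x, y) =
  \int[m2]_(y in D2) \int[m1]_(x in D1) f (x, y).
Proof.
move=> mD1 mD2; pose g := f \_ (D1 `*` D2).
have gE x y : g (x, y) = if (x \in D1) && (y \in D2) then f (x, y) else 0.
  by rewrite /g patchE in_setX.
transitivity (\int[m1]_x \int[m2]_y g (x, y)).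
  rewrite integral_mkcond; apply: eq_integral => x _; rewrite patchE.
  case: ifPn => xD; last first.
    by rewrite integral0_eq// => y _; rewrite gE (negbTE xD).
  by rewrite integral_mkcond; apply: eq_integral => y _; rewrite patchE gE xD.
rewrite fubini_tonelli; last 2 first.
- apply/(measurable_restrictT _ _).1; last exact: measurable_funTS.
  exact: measurableX.
- by move=> p; rewrite /g patchE; case: ifPn.
rewrite [RHS]integral_mkcond; apply: eq_integral => y _; rewrite patchE.
case: ifPn => yD; last first.
  by rewrite integral0_eq// => x _; rewrite gE (negbTE yD) andbF.
by rewrite [RHS]integral_mkcond; apply: eq_integral => x _; rewrite patchE gE yD andbT.
Qed.

End iterated.

Section periodic.
Local Open Scope ereal_scope.
Context (R : realType).
Local Notation mu := (@lebesgue_measure R).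
Variables (T : R) (k : R -> \bar R).
Hypotheses (T0 : (0 < T)%R) (mk : measurable_fun setT k).
Hypotheses (k0 : forall x, 0 <= k x) (kT : forall x, k (x + T)%R = k x).

Let ge0_integral_itvU (a b c : R) : (a <= b)%R -> (b <= c)%R ->
  \int[mu]_(x in `[a, c[) k x =
  \int[mu]_(x in `[a, b[) k x + \int[mu]_(x in `[b, c[) k x.
Proof.
move=> ab bc; rewrite (@itv_bndbnd_setU _ _ _ (BLeft b)) ?bnd_simp//.
rewrite ge0_integral_setU//; first exact: measurable_funTS.
apply/disj_setPRL => x /=; rewrite !in_itv/= => /andP[bx _].
by apply/negP; rewrite negb_and -leNgt bx orbT.
Qed.

Let integral_shift (a b : R) :
  \int[mu]_(x in `[(a + T)%R, (b + T)%R[) k x = \int[mu]_(x in `[a, b[) k x.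
Proof.
rewrite (@ge0_integral_affine_set _ _ _ 1%R T)//.
rewrite (_ : _ @^-1` _ = `[a, b[%classic).
  by apply: eq_integral => x _; rewrite mul1r kT mule1.
by apply/seteqP; split => x/=; rewrite !in_itv/= mul1r lerD2r ltrD2r.
Qed.

(** The piece [[a, b[] is cut off on the left and translated by [T] onto the right end. *)
Lemma integral_periodic_shift (a b : R) : (a <= b)%R -> (b <= a + T)%R ->
  \int[mu]_(x in `[a, (a + T)%R[) k x = \int[mu]_(x in `[b, (b + T)%R[) k x.
Proof.
move=> ab baT; rewrite (ge0_integral_itvU ab baT) addeC.
by rewrite [RHS](ge0_integral_itvU baT) ?lerD2r// integral_shift.
Qed.

(** Rescaling by [n] spreads one period over [n] periods, and the factor [1 / n] compensates. This
    is the angular part of the substitution [w = z^M]. *)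
Lemma integral_periodic_mul n : (0 < n)%N ->
  \int[mu]_(x in `[0%R, T[) k (n%:R * x)%R = \int[mu]_(x in `[0%R, T[) k x.
Proof.
move=> n0; have n0' : (0 < n%:R :> R)%R by rewrite ltr0n.
have step m : \int[mu]_(x in `[(m%:R * T)%R, (m.+1%:R * T)%R[) k x =
              \int[mu]_(x in `[0%R, T[) k x.
  elim: m => [|m IH]; first by rewrite mul0r mul1r.
  rewrite -IH -[RHS]integral_shift.
  have E j : (j.+1%:R * T = j%:R * T + T)%R by rewrite -natr1 mulrDl mul1r.
  by rewrite -!E.
have mult m : \int[mu]_(x in `[0%R, (m%:R * T)%R[) k x =
              m%:R%:E * \int[mu]_(x in `[0%R, T[) k x.
  elim: m => [|m IH]; first by rewrite mul0r set_itvco0 integral_set0 mul0e.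
  rewrite (@ge0_integral_itvU _ (m%:R * T)%R); last 2 first.
  - by rewrite mulr_ge0// ltW.
  - by rewrite ler_pM2r// ler_nat.
  rewrite IH step -natr1 EFinD ge0_muleDl ?mul1e ?lee_fin//.
have := mult n; rewrite (@ge0_integral_affine_set _ _ _ n%:R 0%R)//.
rewrite (_ : _ @^-1` _ = `[0%R, T[%classic); last first.
  by apply/seteqP; split => x/=; rewrite !in_itv/= addr0 ltr_pM2l// pmulr_rge0.
under eq_integral do rewrite addr0 muleC.
rewrite ge0_integralZl//; last first.
  apply: measurable_funTS; apply: (measurableT_comp mk).
  exact: measurable_funM.
move=> /(congr1 (fun x => (n%:R^-1)%:E * x)); rewrite !muleA -!EFinM.
by rewrite mulVf ?lt0r_neq0// !mul1e.
Qed.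

End periodic.

(** * Polar coordinates *)

Section polar.
Local Open Scope ereal_scope.
Context (R : realType).
Local Notation mu := (@lebesgue_measure R).

Lemma ge0_integral_opp (f : R -> \bar R) :
  measurable_fun setT f -> (forall x, 0 <= f x) ->
  \int[mu]_x f (- x)%R = \int[mu]_x f x.
Proof.
move=> mf f0.
transitivity (\int[pushforward mu (-%R : _ -> measurableTypeR R)]_x f x).
  by rewrite ge0_integral_pushforward//= preimage_setT.
by apply: eq_measure_integral => A mA _; exact: lebesgue_measureN.
Qed.

Lemma ge0_integral_halves (f : R -> \bar R) :
  measurable_fun setT f -> (forall x, 0 <= f x) ->
  \int[mu]_x f x =
  \int[mu]_(x in `]0%R, +oo[) f x + \int[mu]_(x in `]0%R, +oo[) f (- x)%R.
Proof.
move=> mf f0.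
have mfN : measurable_fun setT (f \o -%R) by exact: measurableT_comp.
rewrite -(set_itvNyy R) (@itv_bndbnd_setU _ _ _ (BRight 0%R))//.
rewrite ge0_integral_setU//; last 2 first.
- exact: measurable_funTS.
- apply/disj_setPRL => x /=; rewrite !in_itv/= andbT => x0.
  by apply/negP; rewrite -ltNge.
rewrite addeC; congr (_ + _).
rewrite integral_itv_obnd_cbnd; last exact: measurable_funTS.
rewrite (@ge0_integration_by_substitution0 _ (f \o -%R))//=.
by apply: eq_integral => x _; rewrite opprK.
Qed.

(** The tangent substitution covers the right half-plane, and after a reflection the left one. Their
    two ranges of angles form a full turn starting at [- (pi / 2)], which periodicity moves to 0. *)
Lemma ge0_integral_half_turns (k : R -> \bar R) :
  measurable_fun setT k -> (forall x, 0 <= k x) ->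
  (forall x, k (x + pi *+ 2)%R = k x) ->
  \int[mu]_(t in `](- (pi / 2))%R, (pi / 2)%R[) k t +
  \int[mu]_(t in `](pi / 2)%R, (pi / 2 + pi)%R[) k t =
  \int[mu]_(t in `[0%R, (pi *+ 2)%R[) k t.
Proof.
move=> mk k0 k2pi.
rewrite !integral_itv_obnd_cbnd; [|exact: measurable_funTS..].
have pi0 := @pi_gt0 R.
rewrite -ge0_integral_setU//; last 2 first.
- exact: measurable_funTS.
- apply/disj_setPRL => x /=; rewrite !in_itv/= => /andP[bx _].
  by apply/negP; rewrite negb_and -!leNgt bx orbT.
rewrite -itv_bndbnd_setU ?bnd_simp; [|lra..].
have -> : (pi / 2 + pi = - (pi / 2) + pi *+ 2 :> R)%R by rewrite (mulr2n pi); lra.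
rewrite (integral_periodic_shift mk k0 k2pi (b := 0%R)) ?add0r//; first by lra.
by rewrite (mulr2n pi); lra.
Qed.

Variable f : R * R -> \bar R.
Hypotheses (mf : measurable_fun setT f) (f0 : forall p, 0 <= f p).

Let I := `](- (pi / 2))%R, (pi / 2)%R[%classic : set R.

Let mcos : measurable_fun setT (@cos R).
Proof. by apply: continuous_measurable_fun; exact: continuous_cos. Qed.

Let msin : measurable_fun setT (@sin R).
Proof. by apply: continuous_measurable_fun; exact: continuous_sin. Qed.

Let mcosV : measurable_fun setT (fun t : R => cos t `^ (-1))%R.
Proof. exact: (measurableT_comp (measurable_powR _)). Qed.

Let mcos2V : measurable_fun setT (fun t : R => (cos t ^+ 2) `^ (-1))%R.
Proof.
by apply: (measurableT_comp (measurable_powR _)); exact: measurable_funX.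
Qed.

(* [y = x tan t], then [x = r cos t]. *)
Let polar_half (h : R * R -> \bar R) :
  measurable_fun setT h -> (forall p, 0 <= h p) ->
  \int[mu]_(x in `]0%R, +oo[) \int[mu]_y h (x, y) =
  \int[mu]_(t in I) \int[mu]_(r in `]0%R, +oo[)
    (h (r * cos t, r * sin t)%R * `|r|%:E).
Proof.
move=> mh h0.
have mh2 x : measurable_fun setT (fun y => h (x, y)) by exact: measurable_fun_pair2.
transitivity (\int[mu]_(x in `]0%R, +oo[) \int[mu]_(t in I)
    (h (x, x * (sin t * cos t `^ (-1)))%R * (`|x| * (cos t ^+ 2) `^ (-1))%:E)).
  apply: eq_integral => x /set_mem /=; rewrite in_itv/= andbT => x0.
  rewrite (@ge0_integral_affine _ _ x 0%R)//.
  rewrite ge0_integral_tan//; last 2 first.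
  - apply: emeasurable_funM => //; apply: (measurableT_comp (mh2 x)).
    by apply: measurable_funD => //; exact: measurable_funM.
  - by move=> y; rewrite mule_ge0// lee_fin ltW.
  apply: eq_integral => t /set_mem /=; rewrite in_itv/= => ti.
  rewrite addr0 gtr0_norm// -muleA -EFinM; congr (_ * (_ * _)%:E).
  by rewrite powR_inv1// sqr_ge0.
have mtan : measurable_fun setT (fun t : R => sin t * cos t `^ (-1))%R.
  exact: measurable_funM.
pose G (p : R * R) := h (p.1, p.1 * (sin p.2 * cos p.2 `^ (-1)))%R *
  (`|p.1| * (cos p.2 ^+ 2) `^ (-1))%:E.
have mG : measurable_fun setT G.
  apply: emeasurable_funM.
    apply: (measurableT_comp mh); apply: measurable_fun_pair => //.
    apply: measurable_funM => //.
    exact: (measurableT_comp mtan measurable_snd).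
  apply/measurable_EFinP; apply: measurable_funM => //.
    exact: (measurableT_comp _ measurable_fst).
  exact: (measurableT_comp mcos2V measurable_snd).
have G0 p : 0 <= G p by rewrite mule_ge0// lee_fin mulr_ge0// powR_ge0.
transitivity (\int[mu]_(x in `]0%R, +oo[) \int[mu]_(t in I) G (x, t)).
  by apply: eq_integral => x _; apply: eq_integral => t _.
have sw := integral_swap mu mu mG G0 (measurable_itv `]0%R, +oo[)
  (measurable_itv `](- (pi / 2))%R, (pi / 2)%R[).
rewrite sw.
apply: eq_integral => t /set_mem ti /=.
have ct : (0 < cos t)%R by apply: cos_gt0_pihalf; move: ti; rewrite /I/= in_itv.
have mGt : measurable_fun setT (fun x => G (x, t)) by exact: measurable_fun_pair1.
have subst := ge0_integral_affine_set 0%R ct (measurable_itv `]0%R, +oo[)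
  mGt (fun x => G0 (x, t)).
rewrite subst {subst}.
rewrite (_ : _ @^-1` _ = `]0%R, +oo[%classic); last first.
  by apply/seteqP; split => x/=; rewrite !in_itv/= !andbT addr0 pmulr_rgt0.
apply: eq_integral => r _; rewrite addr0 /G/= -muleA -EFinM.
have ct0 := ltW ct.
rewrite normrM (gtr0_norm ct).
have E1 := powR_inv1 ct0.
have E2 := powR_inv1 (sqr_ge0 (cos t)).
rewrite E1.
rewrite E2.
have ctn0 := lt0r_neq0 ct.
congr (h (_, _) * _%:E).
- by ring.
- by field.
- by field.
Qed.

Let k t := \int[mu]_(r in `]0%R, +oo[) (f (r * cos t, r * sin t)%R * `|r|%:E).

Let mf' : measurable_fun setT
  (fun p : R * R => f (p.2 * cos p.1, p.2 * sin p.1)%R * `|p.2|%:E).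
Proof.
apply: emeasurable_funM.
  apply: (measurableT_comp mf); apply: measurable_fun_pair.
    by apply: measurable_funM => //; exact: (measurableT_comp mcos measurable_fst).
  by apply: measurable_funM => //; exact: (measurableT_comp msin measurable_fst).
by apply/measurable_EFinP; exact: (measurableT_comp _ measurable_snd).
Qed.

Let mk : measurable_fun setT k.
Proof.
apply: (@measurable_integral_snd _ _ _ _ _ mu _ mf') => //.
by move=> p; rewrite mule_ge0// lee_fin.
Qed.

Let k0 t : 0 <= k t.
Proof. by apply: integral_ge0 => r _; rewrite mule_ge0// lee_fin. Qed.

(* The factor is [`|r|] rather than [r] so that the integrand is nonnegative
   for all [r]. *)
Lemma ge0_integral_polar :
  \int[mu \x mu]_z f z = \int[mu]_(r in `]0%R, +oo[)
    \int[mu]_(t in `[0%R, (pi *+ 2)%R[)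
      (f (r * cos t, r * sin t)%R * `|r|%:E).
Proof.
have mfF : measurable_fun setT (fubini_F mu f) by exact: measurable_fun_fubini_tonelli_F.
rewrite fubini_tonelli1// ge0_integral_halves//; last first.
  by move=> x; exact: integral_ge0.
(* The left half-plane is reflected through the origin, so that [polar_half] applies to it; the
   reflection is afterwards absorbed by the shift of the angle by [pi]. *)
pose fN (p : R * R) := f (- p.1, - p.2)%R.
have mfN : measurable_fun setT fN.
  apply: (measurableT_comp mf); apply: measurable_fun_pair.
    exact: (measurableT_comp _ measurable_fst).
  exact: (measurableT_comp _ measurable_snd).
have -> : \int[mu]_(x in `]0%R, +oo[) fubini_F mu f (- x)%R =
    \int[mu]_(x in `]0%R, +oo[) \int[mu]_y fN (x, y).
  apply: eq_integral => x _; rewrite /fubini_F -[LHS]ge0_integral_opp//.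
  exact: measurable_fun_pair2.
have fN0 p : 0 <= fN p by exact: f0.
rewrite !polar_half//.
have -> : \int[mu]_(t in I) \int[mu]_(r in `]0%R, +oo[)
    (fN (r * cos t, r * sin t)%R * `|r|%:E) =
    \int[mu]_(t in `](pi / 2)%R, (pi / 2 + pi)%R[) k t.
  rewrite [RHS](@ge0_integral_affine_set _ k _ 1%R pi)//.
  rewrite (_ : _ @^-1` _ = I).
    apply: eq_integral => t _; rewrite /k mule1 mul1r cosDpi sinDpi.
    by apply: eq_integral => r _; rewrite /fN/= !mulrN.
  apply/seteqP; split => x/=; rewrite !in_itv/= mul1r ltrD2r -ltrBlDr.
    by rewrite [X in (X < _)%R](_ : _ = - (pi / 2))%R//; lra.
  by rewrite [X in _ -> (X < _)%R && _](_ : _ = - (pi / 2))%R//; lra.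
have mf'0 p : 0 <= f (p.2 * cos p.1, p.2 * sin p.1)%R * `|p.2|%:E.
  by rewrite mule_ge0// lee_fin.
have sw := integral_swap mu mu mf' mf'0
  (measurable_itv `[0%R, (pi *+ 2)%R[) (measurable_itv `]0%R, +oo[).
rewrite /= in sw; rewrite -sw.
have k2pi x : k (x + pi *+ 2)%R = k x by rewrite /k cosD2pi sinD2pi.
exact: (ge0_integral_half_turns mk k0 k2pi).
Qed.

End polar.

(** * Measurability of complex-valued functions *)

Section complex_measurability.
Context (R : realType) d (T : measurableType d).
Implicit Types f g : T -> R[i].

Lemma measurable_Re : measurable_fun setT (@complex.Re R).
Proof.
exact: (measurableT_comp measurable_fst (@measurable_pair_of_complex R)).
Qed.

Lemma measurable_Im : measurable_fun setT (@complex.Im R).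
Proof.
exact: (measurableT_comp measurable_snd (@measurable_pair_of_complex R)).
Qed.

Lemma measurable_Complex (f g : T -> R) :
  measurable_fun setT f -> measurable_fun setT g ->
  measurable_fun setT (fun x => (f x +i* g x)%C).
Proof.
move=> mf mg.
exact: (measurableT_comp (@measurable_complex_of_pair R) (measurable_fun_pair mf mg)).
Qed.

Lemma measurable_funRe f : measurable_fun setT f ->
  measurable_fun setT (fun x => complex.Re (f x)).
Proof. exact: (measurableT_comp measurable_Re). Qed.

Lemma measurable_funIm f : measurable_fun setT f ->
  measurable_fun setT (fun x => complex.Im (f x)).
Proof. exact: (measurableT_comp measurable_Im). Qed.

Lemma measurable_funMc f g : measurable_fun setT f -> measurable_fun setT g ->
  measurable_fun setT (fun x => f x * g x).
Proof.
move=> mf mg; have mr := measurable_funRe mf; have mi := measurable_funIm mf.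
have mr' := measurable_funRe mg; have mi' := measurable_funIm mg.
rewrite (_ : (fun x => _) = fun x =>
  Complex (complex.Re (f x) * complex.Re (g x) - complex.Im (f x) * complex.Im (g x))
   (complex.Re (f x) * complex.Im (g x) + complex.Im (f x) * complex.Re (g x))).
  by apply: measurable_Complex; [apply: measurable_funB|apply: measurable_funD];
    exact: measurable_funM.
by apply/funext => x; case: (f x) => a b; case: (g x) => a' b'.
Qed.

Lemma measurable_funXc f n : measurable_fun setT f ->
  measurable_fun setT (fun x => f x ^+ n).
Proof.
move=> mf; elim: n => [|n IH].
  by under eq_fun do rewrite expr0; exact: measurable_cst.
by under eq_fun do rewrite exprS; exact: measurable_funMc.
Qed.

Lemma measurable_conjc f : measurable_fun setT f ->
  measurable_fun setT (fun x => (f x)^*%C).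
Proof.
move=> mf; rewrite (_ : (fun x => _) =
    fun x => (complex.Re (f x) +i* (- complex.Im (f x)))%C).
  apply: measurable_Complex; first exact: measurable_funRe.
  by apply: measurableT_comp => //; exact: measurable_funIm.
by apply/funext => x; case: (f x).
Qed.

Lemma measurable_real_complex (f : T -> R) : measurable_fun setT f ->
  measurable_fun setT (fun x => (f x)%:C%C).
Proof. by move=> mf; exact: measurable_Complex. Qed.

Lemma measurable_funBc f g : measurable_fun setT f -> measurable_fun setT g ->
  measurable_fun setT (fun x => f x - g x).
Proof.
move=> mf mg; have mr := measurable_funRe mf; have mi := measurable_funIm mf.
have mr' := measurable_funRe mg; have mi' := measurable_funIm mg.
rewrite (_ : (fun x => _) = fun x =>
  Complex (complex.Re (f x) - complex.Re (g x)) (complex.Im (f x) - complex.Im (g x))).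
  by apply: measurable_Complex; exact: measurable_funB.
by apply/funext => x; case: (f x) => a b; case: (g x) => a' b'.
Qed.

Lemma normcE2 (z : R[i]) : normc z = (complex.Re z ^+ 2 + complex.Im z ^+ 2) `^ 2^-1.
Proof. by case: z => a b; rewrite powR12_sqrt// addr_ge0// sqr_ge0. Qed.

Lemma measurable_normc f : measurable_fun setT f ->
  measurable_fun setT (fun x => normc (f x)).
Proof.
move=> mf; under eq_fun do rewrite normcE2.
apply: (measurableT_comp (measurable_powR _)).
apply: measurable_funD; apply: measurable_funX.
  exact: measurable_funRe.
exact: measurable_funIm.
Qed.

End complex_measurability.

(** * Rotations and powers in polar coordinates *)

Section complex_polar.
Context (R : realType).
Local Notation mu := (@lebesgue_measure R).
Local Notation leb := (@lebesgue_complex R).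

Definition polar (r t : R) : R[i] := (r * cos t +i* (r * sin t))%C.

Lemma normc_polar r t : normc (polar r t) = `|r|.
Proof.
by rewrite /= !exprMn -mulrDr cos2Dsin2 mulr1 sqrtr_sqr.
Qed.

Lemma polarM r t r' t' : polar r t * polar r' t' = polar (r * r') (t + t').
Proof.
apply/eqP; rewrite /polar eq_complex/= cosD sinD; apply/andP; split; apply/eqP; ring.
Qed.

Lemma polarX r t n : polar r t ^+ n = polar (r ^+ n) (n%:R * t).
Proof.
elim: n => [|n IH].
  by rewrite !expr0 /polar mul0r cos0 sin0 mulr0 mulr1.
by rewrite !exprS IH polarM -natr1 mulrDl mul1r addrC.
Qed.

Lemma polar_periodic r t : polar r (t + pi *+ 2) = polar r t.
Proof. by rewrite /polar cosD2pi sinD2pi. Qed.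

Lemma measurable_polar d (T : measurableType d) (r t : T -> R) :
  measurable_fun setT r -> measurable_fun setT t ->
  measurable_fun setT (fun x => polar (r x) (t x)).
Proof.
move=> mr mt; apply: measurable_Complex; apply: measurable_funM => //.
  apply: (measurableT_comp _ mt).
  by apply: continuous_measurable_fun; exact: continuous_cos.
apply: (measurableT_comp _ mt).
by apply: continuous_measurable_fun; exact: continuous_sin.
Qed.

Local Open Scope ereal_scope.

Lemma ge0_integral_complex_polar (h : R[i] -> \bar R) :
  measurable_fun setT h -> (forall z, 0 <= h z) ->
  \int[leb]_z h z = \int[mu]_(r in `]0%R, +oo[)
    \int[mu]_(t in `[0%R, (pi *+ 2)%R[) (h (polar r t) * `|r|%:E).
Proof.
move=> mh h0; rewrite ge0_integral_pushforward//= ?preimage_setT.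
rewrite (@ge0_integral_polar _ (h \o @complex_of_pair R))//=.
Qed.

(** In polar coordinates a rotation translates the angle, and the integrand has period [2 pi]. The
    range of [phi] is the one of [integral_periodic_shift]. *)
Lemma ge0_integral_rotation (h : R[i] -> \bar R) (phi : R) :
  (0 <= phi <= pi *+ 2)%R ->
  measurable_fun setT h -> (forall z, 0 <= h z) ->
  \int[leb]_z h (polar 1 phi * z)%R = \int[leb]_z h z.
Proof.
move=> /andP[phi0 phi2pi] mh h0.
pose H z := h (polar 1 phi * z)%R.
have mH : measurable_fun setT H.
  by apply: (measurableT_comp mh); exact: measurable_funMc.
have E1 := ge0_integral_complex_polar mH (fun z => h0 _).
have E2 := ge0_integral_complex_polar mh h0.
rewrite E1 E2 {E1 E2}.
apply: eq_integral => r _.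
have mk : measurable_fun setT (fun t => h (polar r t) * `|r|%:E).
  by apply: emeasurable_funM => //; apply: (measurableT_comp mh); exact: measurable_polar.
have k0 t : 0 <= h (polar r t) * `|r|%:E by rewrite mule_ge0// lee_fin.
have kT t : h (polar r (t + pi *+ 2)%R) * `|r|%:E = h (polar r t) * `|r|%:E.
  by rewrite polar_periodic.
have sh := integral_periodic_shift mk k0 kT phi0.
rewrite add0r in sh; rewrite sh//.
have aff := ge0_integral_affine_set phi ltr01
  (measurable_itv `[phi, (phi + pi *+ 2)%R[) mk k0.
rewrite [RHS]aff (_ : _ @^-1` _ = `[0%R, (pi *+ 2)%R[%classic).
  by apply: eq_integral => t _; rewrite /H polarM !mul1r mule1 addrC.
by apply/seteqP; split => x/=; rewrite !in_itv/= mul1r (addrC x) lerDl ltrD2l.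
Qed.

(** With [w = z^M] and [r = |z|], the radial substitution [s = r^M] contributes [M r^(M-1)], while
    multiplying the angle by [M] leaves the integral over a full turn unchanged. The hypothesis
    relating [V] and [v] is what remains: [r^M] and [r] are the polar Jacobians at [w] and at [z].
    The factor [M] is the Jacobian constant [M^2] divided by the [M] sheets. *)
Lemma ge0_integral_power (M : nat) (V v : R -> R) (h : R[i] -> \bar R) :
  (0 < M)%N ->
  measurable_fun setT V -> (forall r, (0 <= V r)%R) ->
  measurable_fun setT v -> (forall r, (0 <= v r)%R) ->
  (forall r, (0 < r)%R -> (V (r ^+ M) * r ^+ M * r ^+ M.-1 = v r * r)%R) ->
  measurable_fun setT h -> (forall z, 0 <= h z) ->
  \int[leb]_z (h z * (V (normc z))%:E) =
  M%:R%:E * \int[leb]_z (h (z ^+ M)%R * (v (normc z))%:E).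
Proof.
move=> M0 mV V0 mv v0 Vv mh h0.
have pi20 : (0 < pi *+ 2 :> R)%R by rewrite mulrn_wgt0// pi_gt0.
have mnc : measurable_fun setT (fun z : R[i] => normc z) by exact: measurable_normc.
have mhM : measurable_fun setT (fun z : R[i] => h (z ^+ M)%R).
  by apply: (measurableT_comp mh); exact: measurable_funXc.
have mhV : measurable_fun setT (fun z : R[i] => h z * (V (normc z))%:E).
  apply: emeasurable_funM => //.
  by apply/measurable_EFinP; exact: (measurableT_comp mV).
have hV0 z : 0 <= h z * (V (normc z))%:E by rewrite mule_ge0// lee_fin.
have mhv : measurable_fun setT (fun z : R[i] => h (z ^+ M)%R * (v (normc z))%:E).
  apply: emeasurable_funM => //.
  by apply/measurable_EFinP; exact: (measurableT_comp mv).
have hv0 (z : R[i]) : 0 <= h (z ^+ M)%R * (v (normc z))%:E.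
  by rewrite mule_ge0// lee_fin.
have E1 := ge0_integral_complex_polar mhV hV0.
have E2 := ge0_integral_complex_polar mhv hv0.
rewrite E1 E2 {E1 E2}.
pose K (p : R * R) := h (polar p.1 p.2) * (V `|p.1| * `|p.1|)%:E.
have mK : measurable_fun setT K.
  apply: emeasurable_funM.
    by apply: (measurableT_comp mh); apply: measurable_polar.
  apply/measurable_EFinP; apply: measurable_funM.
    by apply: (measurableT_comp mV); exact: (measurableT_comp _ measurable_fst).
  exact: (measurableT_comp _ measurable_fst).
have K0 p : 0 <= K p by rewrite mule_ge0// lee_fin mulr_ge0.
pose k r := \int[mu]_(t in `[0%R, (pi *+ 2)%R[) K (r, t).
have mk : measurable_fun setT k.
  exact: (measurable_integral_snd mu mK K0 (measurable_itv _)).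
have k0 r : 0 <= k r by exact: integral_ge0.
transitivity (\int[mu]_(r in `]0%R, +oo[) k r).
  apply: eq_integral => r _; apply: eq_integral => t _.
  by rewrite normc_polar -muleA -EFinM.
have subst := ge0_integral_exprn M0 mk k0.
rewrite subst {subst}.
pose G (p : R * R) := h (polar p.1 p.2 ^+ M)%R * (v `|p.1| * `|p.1|)%:E.
have mG : measurable_fun setT G.
  apply: emeasurable_funM.
    by apply: (measurableT_comp mhM); apply: measurable_polar.
  apply/measurable_EFinP; apply: measurable_funM.
    by apply: (measurableT_comp mv); exact: (measurableT_comp _ measurable_fst).
  exact: (measurableT_comp _ measurable_fst).
have G0 p : 0 <= G p by rewrite mule_ge0// lee_fin mulr_ge0.
pose g r := \int[mu]_(t in `[0%R, (pi *+ 2)%R[) G (r, t).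
have mg : measurable_fun setT g.
  exact: (measurable_integral_snd mu mG G0 (measurable_itv _)).
have g0 r : 0 <= g r by exact: integral_ge0.
transitivity (M%:R%:E * \int[mu]_(r in `]0%R, +oo[) g r); last first.
  congr (_ * _); apply: eq_integral => r _; apply: eq_integral => t _.
  by rewrite normc_polar -muleA -EFinM.
rewrite -ge0_integralZl//; last exact: measurable_funTS.
apply: eq_integral => r /set_mem/=; rewrite in_itv/= andbT => r0.
pose I := \int[mu]_(t in `[0%R, (pi *+ 2)%R[) h (polar (r ^+ M)%R t).
have mhr s : measurable_fun setT (fun t => h (polar s t)).
  by apply: (measurableT_comp mh); exact: measurable_polar.
have rM0 : (0 < r ^+ M)%R by rewrite exprn_gt0.
have -> : k (r ^+ M)%R = I * (V (r ^+ M) * r ^+ M)%:E.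
  rewrite /k /K/= (gtr0_norm rM0) ge0_integralZr//.
    by apply: measurable_funTS; exact: mhr.
  by rewrite lee_fin mulr_ge0// ltW.
have -> : g r = I * (v r * r)%:E.
  rewrite /g /G/=; under eq_integral do rewrite polarX.
  rewrite (gtr0_norm r0) ge0_integralZr//; last 2 first.
  - apply: measurable_funTS; apply: (measurableT_comp (mhr _)).
    exact: measurable_funM.
  - by rewrite lee_fin mulr_ge0// ltW.
  congr (_ * _); apply: (integral_periodic_mul (k := fun t => h (polar (r ^+ M)%R t))) => //.
  by move=> t; rewrite polar_periodic.
rewrite -muleA -EFinM muleCA -EFinM; congr (_ * _%:E).
by rewrite -Vv//; ring.
Qed.

End complex_polar.

(** * Complex-valued integrals *)

Section has_integral.
Context d (T : measurableType d) (R : realType).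
Variable mu : {measure set T -> \bar R}.

(** Integrability and value are bundled, so that each closure property (linear combinations,
    products, images) transports both at once. *)
Definition has_integral (f : T -> R) (a : R) : Prop :=
  mu.-integrable setT (EFin \o f) /\ (\int[mu]_x (f x)%:E = a%:E)%E.

Lemma has_integralP f : mu.-integrable setT (EFin \o f) ->
  has_integral f (\int[mu]_x f x).
Proof. by move=> If; split=> //; rewrite fineK//; exact: integrable_fin_num. Qed.

Lemma has_integral0 : has_integral (fun=> 0) 0.
Proof. by split; [exact: integrable0|rewrite integral0]. Qed.

Lemma has_integralD f g a b : has_integral f a -> has_integral g b ->
  has_integral (fun x => f x + g x) (a + b).
Proof.
move=> [If fa] [Ig gb]; split.
  by have := integrableD measurableT If Ig.
by under eq_integral do rewrite EFinD; rewrite integralD// EFinD fa gb.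
Qed.

Lemma has_integralZl f a (c : R) : has_integral f a ->
  has_integral (fun x => c * f x) (c * a).
Proof.
move=> [If fa]; split.
  by have := integrableZl measurableT c If.
by under eq_integral do rewrite EFinM; rewrite integralZl// EFinM fa.
Qed.

Lemma has_integralB f g a b : has_integral f a -> has_integral g b ->
  has_integral (fun x => f x - g x) (a - b).
Proof.
move=> fa /(has_integralZl (-1)) gb; have := has_integralD fa gb.
by under eq_fun do rewrite mulN1r; rewrite mulN1r.
Qed.

Definition has_cintegral (f : T -> R[i]) (a : R[i]) : Prop :=
  has_integral (fun x => complex.Re (f x)) (complex.Re a) /\
  has_integral (fun x => complex.Im (f x)) (complex.Im a).

Definition cintegral (f : T -> R[i]) : R[i] :=
  (\int[mu]_x complex.Re (f x) +i* \int[mu]_x complex.Im (f x))%C.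

Lemma has_cintegral_cintegral f a : has_cintegral f a -> cintegral f = a.
Proof.
case: a => a b [[_ fa] [_ fb]]; rewrite /cintegral /Rintegral.
by move: fa fb => /= -> ->.
Qed.

Lemma eq_has_cintegral f g a : f =1 g -> has_cintegral f a -> has_cintegral g a.
Proof. by move=> /funext ->. Qed.

Lemma has_cintegral0 : has_cintegral (fun=> 0) 0.
Proof. by split; exact: has_integral0. Qed.

Lemma has_cintegralD f g a b : has_cintegral f a -> has_cintegral g b ->
  has_cintegral (fun x => f x + g x) (a + b).
Proof.
move=> [rf jf] [rg jg]; split.
  have := has_integralD rf rg.
  rewrite (_ : complex.Re (a + b) = complex.Re a + complex.Re b).
    by congr has_integral; apply/funext => x; case: (f x); case: (g x).
  by case: (a); case: (b).
have := has_integralD jf jg.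
rewrite (_ : complex.Im (a + b) = complex.Im a + complex.Im b).
  by congr has_integral; apply/funext => x; case: (f x); case: (g x).
by case: (a); case: (b).
Qed.

Lemma has_cintegral_sum (I : Type) (r : seq I) (f : I -> T -> R[i])
    (a : I -> R[i]) : (forall i, has_cintegral (f i) (a i)) ->
  has_cintegral (fun x => \sum_(i <- r) f i x) (\sum_(i <- r) a i).
Proof.
move=> fa; elim: r => [|i r IH].
  rewrite big_nil; apply: (eq_has_cintegral _ has_cintegral0) => x.
  by rewrite big_nil.
rewrite big_cons; apply: (eq_has_cintegral _ (has_cintegralD (fa i) IH)) => x.
by rewrite big_cons.
Qed.

Lemma has_cintegralZl f a (c : R[i]) : has_cintegral f a ->
  has_cintegral (fun x => c * f x) (c * a).
Proof.
case: c => c c' [rf jf]; split.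
  have := has_integralB (has_integralZl c rf) (has_integralZl c' jf).
  rewrite (_ : complex.Re (_ * a) = c * complex.Re a - c' * complex.Im a).
    by congr has_integral; apply/funext => x; case: (f x).
  by case: (a).
have := has_integralD (has_integralZl c jf) (has_integralZl c' rf).
rewrite (_ : complex.Im (_ * a) = c * complex.Im a + c' * complex.Re a).
  by congr has_integral; apply/funext => x; case: (f x).
by case: (a).
Qed.

Lemma has_cintegral_dominated (f : T -> R[i]) (g : T -> R) :
  measurable_fun setT f -> mu.-integrable setT (EFin \o g) ->
  (forall x, normc (f x) <= g x) -> has_cintegral f (cintegral f).
Proof.
move=> mf Ig fg; split; apply: has_integralP; apply: (le_integrable _ _ _ Ig) => //.
- by apply/measurable_EFinP; exact: measurable_funRe.
- move=> x _; rewrite /= lee_fin (le_trans _ (le_trans (fg x) (ler_norm _)))//.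
  case: (f x) => a b /=; rewrite -sqrtr_sqr ler_wsqrtr// lerDl.
  exact: sqr_ge0.
- by apply/measurable_EFinP; exact: measurable_funIm.
- move=> x _; rewrite /= lee_fin (le_trans _ (le_trans (fg x) (ler_norm _)))//.
  case: (f x) => a b /=; rewrite -sqrtr_sqr ler_wsqrtr// lerDr.
  exact: sqr_ge0.
Qed.

End has_integral.

(** * Integrals over product spaces and tuples *)

Section product.
Context d1 d2 (T1 : measurableType d1) (T2 : measurableType d2) (R : realType).
Variables (m1 : {sigma_finite_measure set T1 -> \bar R}).
Variables (m2 : {sigma_finite_measure set T2 -> \bar R}).

Lemma has_integral_prod (f : T1 -> R) (g : T2 -> R) a b :
  has_integral m1 f a -> has_integral m2 g b ->
  has_integral (m1 \x m2)%E (fun p => f p.1 * g p.2) (a * b).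
Proof.
move=> [If fa] [Ig gb].
have mf := measurable_int _ If; have mg := measurable_int _ Ig.
have mf' : measurable_fun setT f by exact/measurable_EFinP.
have mg' : measurable_fun setT g by exact/measurable_EFinP.
have mfg : measurable_fun setT (fun p : T1 * T2 => (f p.1 * g p.2)%:E).
  apply/measurable_EFinP; apply: measurable_funM.
    exact: (measurableT_comp mf' measurable_fst).
  exact: (measurableT_comp mg' measurable_snd).
have Ifg : (m1 \x m2)%E.-integrable setT (fun p => (f p.1 * g p.2)%:E).
  apply/integrable12ltyP => //=.
  have mnf : measurable_fun setT (fun x => `|f x|%:E).
    by apply/measurable_EFinP; exact: measurableT_comp.
  have mng : measurable_fun setT (fun x => `|g x|%:E).
    by apply/measurable_EFinP; exact: measurableT_comp.
  under eq_integral => x _.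
    under eq_integral do rewrite normrM EFinM.
    rewrite (@ge0_integralZl _ _ _ m2)//.
    over.
  rewrite (@ge0_integralZr _ _ _ m1)//; last exact: integral_ge0.
  apply: lte_mul_pinfty; first exact: integral_ge0.
    by rewrite ge0_fin_numE ?integral_ge0//; have /integrableP[] := If.
  by have /integrableP[] := Ig.
split=> //.
have <- := integral12_prod_meas1 Ifg.
rewrite /fubini_F/=.
under eq_integral => x _.
  under eq_integral do rewrite EFinM.
  rewrite integralZl// gb.
  over.
by rewrite integralZr// fa EFinM.
Qed.

Lemma has_cintegral_prod (f : T1 -> R[i]) (g : T2 -> R[i]) a b :
  has_cintegral m1 f a -> has_cintegral m2 g b ->
  has_cintegral (m1 \x m2)%E (fun p => f p.1 * g p.2) (a * b).
Proof.
move=> [rf jf] [rg jg]; split.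
  have := has_integralB (has_integral_prod rf rg) (has_integral_prod jf jg).
  rewrite (_ : complex.Re (a * b) = complex.Re a * complex.Re b - complex.Im a * complex.Im b).
    by congr has_integral; apply/funext => x; case: (f _); case: (g _).
  by case: (a); case: (b).
have := has_integralD (has_integral_prod rf jg) (has_integral_prod jf rg).
rewrite (_ : complex.Im (a * b) = complex.Re a * complex.Im b + complex.Im a * complex.Re b).
  by congr has_integral; apply/funext => x; case: (f _); case: (g _).
by case: (a); case: (b).
Qed.

End product.

Section pushforward.
Context d1 d2 (T1 : measurableType d1) (T2 : measurableType d2) (R : realType).
Variables (mu : {measure set T1 -> \bar R}) (phi : T1 -> T2).
Hypothesis mphi : measurable_fun setT phi.

(** Stated for a measure [nu] that agrees with the image measure on measurable sets, so that it
    applies to [tuple_measure], which carries its own measure structure. *)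
Lemma has_integral_pushforward (nu : {measure set T2 -> \bar R}) (f : T2 -> R) a :
  (forall A, measurable A -> nu A = pushforward mu phi A) ->
  measurable_fun setT f -> has_integral mu (f \o phi) a -> has_integral nu f a.
Proof.
move=> nuE mf [If fa].
have mf' : measurable_fun setT (EFin \o f) by exact/measurable_EFinP.
have Ip : (pushforward mu phi).-integrable setT (EFin \o f).
  by apply: integrable_pushforward => //=; rewrite ?preimage_setT.
have E (g : T2 -> \bar R) : (\int[nu]_x g x = \int[pushforward mu phi]_x g x)%E.
  by apply: eq_measure_integral => A mA _; exact: nuE.
split.
  apply/integrableP; split=> //; rewrite E.
  by have /integrableP[] := Ip.
by rewrite E integral_pushforward//= preimage_setT.
Qed.

Lemma has_cintegral_pushforward (nu : {measure set T2 -> \bar R}) (f : T2 -> R[i]) a :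
  (forall A, measurable A -> nu A = pushforward mu phi A) ->
  measurable_fun setT f -> has_cintegral mu (f \o phi) a -> has_cintegral nu f a.
Proof.
move=> nuE mf [rf jf]; split.
  by apply: has_integral_pushforward nuE (measurable_funRe mf) rf.
by apply: has_integral_pushforward nuE (measurable_funIm mf) jf.
Qed.

End pushforward.

Section tuple_prod.
Context d (T : measurableType d) (R : realType).
Variable mu : {sigma_finite_measure set T -> \bar R}.

Lemma measurable_tuple_prodc n (h : 'I_n -> T -> R[i]) :
  (forall i, measurable_fun setT (h i)) ->
  measurable_fun setT (fun z : n.-tuple T => \prod_i h i (tnth z i)).
Proof.
move=> mh; elim: (index_enum _) => [|i r IH].
  by under eq_fun do rewrite big_nil; exact: measurable_cst.
under eq_fun do rewrite big_cons.
apply: measurable_funMc => //.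
exact: (measurableT_comp (mh i) (measurable_tnth i)).
Qed.

Lemma has_cintegral_tuple_prod n (h : 'I_n -> T -> R[i]) (a : 'I_n -> R[i]) :
  (forall i, measurable_fun setT (h i)) ->
  (forall i, has_cintegral mu (h i) (a i)) ->
  has_cintegral (tuple_measure mu n) (fun z => \prod_i h i (tnth z i)) (\prod_i a i).
Proof.
elim: n h a => [|n IH] h a mh ha.
  have cst (c : R) : has_integral (tuple_measure mu 0) (fun=> c) c.
    have E (f : 0.-tuple T -> \bar R) : measurable_fun setT f ->
        (\int[tuple_measure mu 0]_x f x = f [tuple])%E.
      move=> mf; rewrite /= integral_dirac// diracE mem_set// mul1e//.
    split; last by have := E (fun=> c%:E) (measurable_cst _).
    apply/integrableP; split; first exact: measurable_cst.
    by rewrite (E (fun=> `|c|%:E)) ?ltry//; exact: measurable_cst.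
  rewrite big_ord0; apply: (@eq_has_cintegral _ _ _ _ (fun=> 1)) => [x|].
    by rewrite big_ord0.
  by split; exact: cst.
have := has_cintegral_prod (ha ord0)
  (IH _ _ (fun i => mh (lift ord0 i)) (fun i => ha (lift ord0 i))).
rewrite big_ord_recl => ha'.
apply: (has_cintegral_pushforward (@measurable_cons_pair _ T n)
  (mu := (mu \x tuple_measure mu n)%E)) => //.
  exact: measurable_tuple_prodc.
apply: eq_has_cintegral ha' => p /=; rewrite big_ord_recl; congr (_ * _).
by apply: eq_bigr => i _; congr (h _ _); rewrite !(tnth_nth p.1).
Qed.

End tuple_prod.

(** * Determinants and Andreief's identity *)

(** Writing [t = s * u] cancels the signs of [s], and reindexing the product by [s] leaves the
    determinant, once for each of the [n!] permutations [s]. *)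
Lemma sum_perm_pair_det (F : comNzRingType) n (m : 'I_n -> 'I_n -> F) :
  \sum_(s : 'S_n) \sum_(t : 'S_n) (-1) ^+ s * (-1) ^+ t * \prod_i m (s i) (t i) =
  n`!%:R * \det (\matrix_(i, j) m i j).
Proof.
transitivity (\sum_(s : 'S_n) \det (\matrix_(i, j) m i j)); last first.
  by rewrite sumr_const card_Sn mulr_natl.
apply: eq_bigr => s _; rewrite (reindex_inj (mulgI s)).
apply: eq_bigr => u _; rewrite odd_permM signr_addb mulrA -signr_addb addbb mul1r.
congr (_ * _); rewrite [RHS](reindex_inj (@perm_inj _ s)).
by apply: eq_bigr => i _; rewrite mxE permM.
Qed.

Section block_determinant.
Context (F : comNzRingType).

(** Rows and columns undergo the same permutation, so the two signs cancel. The sizes are allowed to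
    differ syntactically, as [n + #|C|] and [N] do below. *)
Lemma det_mxsub_bij m n (f : 'I_m -> 'I_n) (A : 'M[F]_n) : bijective f ->
  \det (mxsub f f A) = \det A.
Proof.
move=> bf; have mn : m = n.
  by have := bij_eq_card bf; rewrite !card_ord.
subst m; have fi := bij_inj bf.
have -> : mxsub f f A = row_perm (perm fi) (col_perm (perm fi) A).
  by apply/matrixP => i j; rewrite !mxE !permE.
rewrite row_permE col_permE !det_mulmx !det_perm odd_permV.
by rewrite mulrCA -signr_addb addbb mulr1.
Qed.

(** Listing the image of [e] first and its complement [C] afterwards makes [B] block diagonal, with
    an identity block on [C]. *)
Lemma det_identity_outside n N (e : 'I_n -> 'I_N) (B : 'M[F]_N) : injective e ->
  (forall i j, i \notin codom e -> B i j = (i == j)%:R) ->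
  (forall i j, i \in codom e -> j \notin codom e -> B i j = 0) ->
  \det B = \det (mxsub e e B).
Proof.
move=> ei Bout Bin.
pose C := [set i | i \notin codom e]%SET.
pose f (x : 'I_(n + #|C|)) :=
  match fintype.split x with inl a => e a | inr b => enum_val b end.
have fE1 a : f (lshift _ a) = e a by rewrite /f (unsplitK (inl a)).
have fE2 b : f (rshift _ b) = enum_val b by rewrite /f (unsplitK (inr b)).
have Cout (b : 'I_#|C|) : enum_val b \notin codom e by have := enum_valP b; rewrite inE.
have fi : injective f.
  move=> x y; rewrite -(splitK x) -(splitK y).
  case: (fintype.split x) => a; case: (fintype.split y) => b /=; rewrite ?fE1 ?fE2.
  - by move=> /ei ->.
  - by move=> E; have := Cout b; rewrite -E codom_f.
  - by move=> E; have := Cout a; rewrite E codom_f.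
  - by move=> /enum_val_inj ->.
have fb : bijective f.
  apply: inj_card_bij => //; rewrite !card_ord.
  have -> : #|C| = (N - n)%N.
    rewrite cardsE -[X in (X - _)%N](card_ord N) -(cardC (mem (codom e))).
    by rewrite card_codom// card_ord addKn.
  by rewrite -leq_subLR.
rewrite -(det_mxsub_bij B fb).
have -> : mxsub f f B = block_mx (mxsub e e B) 0 0 1%:M.
  rewrite -[LHS]submxK; congr block_mx; apply/matrixP => a b; rewrite !mxE ?fE1 ?fE2.
  - by [].
  - by rewrite Bin// codom_f.
  - by rewrite Bout//; case: eqP => // E; have := Cout a; rewrite E codom_f.
  - by rewrite Bout//; rewrite (inj_eq enum_val_inj).
by rewrite det_ublock det1 mulr1.
Qed.

(** Instead of sorting all indices into diagonal blocks of varying sizes, [A] is factored as a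
    product over [k] of matrices that have the rows of [A] in class [k] and identity rows
    elsewhere. *)
Lemma det_blocks N (K : finType) (c : 'I_N -> K) (n : K -> nat)
    (e : forall k, 'I_(n k) -> 'I_N) (A : 'M[F]_N) :
  (forall k, injective (e k)) ->
  (forall k i, (i \in codom (e k)) = (c i == k)) ->
  (forall i j, c i != c j -> A i j = 0) ->
  \det A = \prod_k \det (mxsub (e k) (e k) A).
Proof.
move=> ei ec A0.
(* [B r] interpolates between the identity, for empty [r], and [A], when [r] lists all classes. *)
pose B (r : seq K) : 'M[F]_N := \matrix_(i, j) if c i \in r then A i j else (i == j)%:R.
have step k r : k \notin r -> B (k :: r) = B [:: k] *m B r.
  move=> kr; apply/matrixP => i j; rewrite mxE [RHS]mxE inE.
  have [cik|cik] /= := eqVneq (c i) k.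
    rewrite (bigD1 j)//= big1 ?addr0 => [|l lj]; rewrite !mxE inE cik eqxx.
      case: ifPn => cjr; last by rewrite eqxx mulr1.
      by rewrite A0 ?mul0r// cik; apply: contraNneq kr => ->.
    case: ifPn => clr; last by rewrite (negbTE lj) mulr0.
    by rewrite A0 ?mul0r// cik; apply: contraNneq kr => ->.
  rewrite (bigD1 i)//= big1 ?addr0 => [|l li]; rewrite !mxE inE (negbTE cik).
    by rewrite eqxx mul1r.
  by rewrite eq_sym (negbTE li) mul0r.
have detB r : uniq r -> \det (B r) = \prod_(k <- r) \det (mxsub (e k) (e k) A).
  elim: r => [_|k r IH /= /andP[kr ur]].
    by rewrite big_nil (_ : B _ = 1%:M) ?det1//; apply/matrixP => i j; rewrite !mxE.
  rewrite big_cons step// det_mulmx IH//; congr (_ * _).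
  rewrite (@det_identity_outside _ _ (e k))//.
  - congr (\det _); apply/matrixP => a b; rewrite !mxE inE -ec codom_f//.
  - by move=> i j; rewrite ec mxE inE => /negbTE ->.
  - move=> i j; rewrite !ec mxE inE => /eqP cik cjk; rewrite cik eqxx A0//.
    by rewrite cik eq_sym.
have -> : \prod_k \det (mxsub (e k) (e k) A) =
    \prod_(k <- enum K) \det (mxsub (e k) (e k) A).
  by rewrite big_enum.
rewrite -detB ?enum_uniq//; congr (\det _); apply/matrixP => i j.
by rewrite mxE mem_enum.
Qed.

End block_determinant.

Section andreief.
Context (R : realType).
Local Notation leb := (@lebesgue_complex R).

Lemma sqr_normc (z : R[i]) : ((normc z ^+ 2)%:C)%C = z * z^*%C.
Proof.
case: z => a b /=; rewrite sqr_sqrtr ?addr_ge0 ?sqr_ge0//.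
apply/eqP; rewrite eq_complex/=; apply/andP; split; apply/eqP; ring.
Qed.

Lemma sq_vandermonde_det n (z : n.-tuple R[i]) :
  ((sq_vandermonde z)%:C)%C =
  \det (\matrix_(i < n, j < n) tnth z i ^+ j) *
  \det (\matrix_(i < n, j < n) (tnth z i)^*%C ^+ j).
Proof.
have E (w : 'I_n -> R[i]) : \det (\matrix_(i < n, j < n) w i ^+ j) =
    \prod_(i < n) \prod_(j < n | (i < j)%N) (w j - w i).
  rewrite -det_tr (_ : _^T = Vandermonde n (\row_j w j)) ?det_Vandermonde.
    by apply: eq_bigr => i _; apply: eq_bigr => j _; rewrite !mxE.
  by apply/matrixP => i j; rewrite !mxE.
rewrite !E -big_split rmorph_prod/=; apply: eq_bigr => i _.
rewrite -big_split rmorph_prod/=; apply: eq_bigr => j _.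
by rewrite -rmorphB/= -sqr_normc -opprB normcN.
Qed.

(** Expanding both Vandermonde determinants over permutations [s] and [t] turns the integrand into a
    finite combination of products of one-variable functions, the term of [s, t] integrating to the
    product of the [m (s i) (t i)]. *)
Lemma andreief n (h : R[i] -> R) (m : nat -> nat -> R[i]) :
  measurable_fun setT h ->
  (forall i j, (i < n)%N -> (j < n)%N ->
    has_cintegral leb (fun z => z ^+ i * z^*%C ^+ j * (h z)%:C%C) (m i j)) ->
  has_cintegral (tuple_measure leb n)
    (fun z => (sq_vandermonde z * \prod_i h (tnth z i))%:C%C)
    (n`!%:R * \det (\matrix_(i < n, j < n) m i j)).
Proof.
move=> mh hm.
rewrite -sum_perm_pair_det.
apply: (@eq_has_cintegral _ _ _ _ (fun z : n.-tuple R[i] =>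
  \sum_(s : 'S_n) \sum_(t : 'S_n) (-1) ^+ s * (-1) ^+ t *
  \prod_i (tnth z i ^+ s i * (tnth z i)^*%C ^+ t i * (h (tnth z i))%:C%C))).
  move=> z; rewrite rmorphM/= sq_vandermonde_det rmorph_prod/=.
  rewrite /determinant big_distrl big_distrl/=; apply: eq_bigr => s _.
  rewrite big_distrr big_distrl/=; apply: eq_bigr => t _.
  rewrite big_split big_split/=.
  rewrite [X in _ = X * _]mulrACA -[RHS]mulrA; congr (_ * (_ * _ * _)).
    by apply: eq_bigr => i _; rewrite mxE.
  by apply: eq_bigr => i _; rewrite mxE.
apply: has_cintegral_sum => s; apply: has_cintegral_sum => t.
apply: has_cintegralZl.
have mh' (i : 'I_n) : measurable_fun setT
    (fun z : R[i] => z ^+ s i * z^*%C ^+ t i * (h z)%:C%C).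
  apply: measurable_funMc; last exact: measurable_real_complex.
  apply: measurable_funMc; first exact: measurable_funXc.
  by apply: measurable_funXc; exact: measurable_conjc.
have := has_cintegral_tuple_prod mh' (fun i => hm (s i) (t i) (ltn_ord _) (ltn_ord _)).
exact.
Qed.

End andreief.

(** * Moments of the Ginibre weight *)

Section invariance.
Context (R : realType).
Local Notation leb := (@lebesgue_complex R).

Lemma has_integral_rotation (phi : R) (f : R[i] -> R) a :
  0 <= phi <= pi *+ 2 ->
  has_integral leb f a -> has_integral leb (fun z => f (polar 1 phi * z)) a.
Proof.
move=> phi2pi [If fa].
have mf : measurable_fun setT (EFin \o f) by exact: measurable_int If.
have mfu : measurable_fun setT (EFin \o f \o *%R (polar 1 phi)).
  by apply: (measurableT_comp mf); exact: measurable_funMc.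
split.
  apply/integrableP; split; first exact: mfu.
  rewrite (ge0_integral_rotation (h := fun z => `|(f z)%:E|%E))//.
    by have /integrableP[] := If.
  exact: measurableT_comp.
rewrite -fa integralE [RHS]integralE; congr (_ - _)%E.
  rewrite -(ge0_integral_rotation phi2pi (measurable_funepos mf) (fun z => funepos_ge0 _ _)).
  by apply: eq_integral => z _; rewrite !funeposE.
rewrite -(ge0_integral_rotation phi2pi (measurable_funeneg mf) (fun z => funeneg_ge0 _ _)).
by apply: eq_integral => z _; rewrite !funenegE.
Qed.

Let maxe_mulr (a b : R) : 0 <= b ->
  (maxe (a * b)%:E 0 = maxe a%:E 0 * b%:E)%E.
Proof.
move=> b0; have [a0|a0] := leP 0 a.
  by rewrite !max_l ?lee_fin ?mulr_ge0// EFinM.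
have a0' := ltW a0; rewrite [in RHS]max_r ?lee_fin// mul0e max_r//.
by rewrite lee_fin mulr_le0_ge0.
Qed.

(** [ge0_integral_power] is applied to the absolute value of [f] for integrability, then to its
    positive and negative parts; the nonnegative radial weights factor out of these parts by
    [maxe_mulr]. *)
Lemma has_integral_power (M : nat) (V v : R -> R) (f : R[i] -> R) a :
  (0 < M)%N ->
  measurable_fun setT V -> (forall r, 0 <= V r) ->
  measurable_fun setT v -> (forall r, 0 <= v r) ->
  (forall r, 0 < r -> V (r ^+ M) * r ^+ M * r ^+ M.-1 = v r * r) ->
  measurable_fun setT f ->
  has_integral leb (fun z => f (z ^+ M) * v (normc z)) a ->
  has_integral leb (fun z => f z * V (normc z)) (M%:R * a).
Proof.
move=> M0 mV V0 mv v0 Vv mf [If fa].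
have mEf : measurable_fun setT (EFin \o f) by exact/measurable_EFinP.
have Vn0 z : 0 <= V (normc z) by [].
have vn0 z : 0 <= v (normc z) by [].
have subst := ge0_integral_power M0 mV V0 mv v0 Vv.
have mnc : measurable_fun setT (fun z : R[i] => normc z) by exact: measurable_normc.
have mfV : measurable_fun setT (fun z : R[i] => (f z * V (normc z))%:E).
  apply/measurable_EFinP; apply: measurable_funM => //.
  exact: (measurableT_comp mV).
split.
  apply/integrableP; split; first exact: mfV.
  under eq_integral do rewrite /= normrM (ger0_norm (Vn0 _)) EFinM.
  rewrite (subst (fun z => `|f z|%:E))//.
    have /integrableP[_] := If.
    under eq_integral do rewrite /= normrM (ger0_norm (vn0 _)) EFinM.
    by move=> foo; apply: lte_mul_pinfty; rewrite // lee_fin.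
  by apply/measurable_EFinP; exact: measurableT_comp.
pose F z := (f z * V (normc z))%:E; pose G z := (f (z ^+ M) * v (normc z))%:E.
have posE : (\int[leb]_z F^\+ z = M%:R%:E * \int[leb]_z G^\+ z)%E.
  transitivity (\int[leb]_z ((EFin \o f)^\+ z * (V (normc z))%:E))%E.
    by apply: eq_integral => z _; rewrite !funeposE maxe_mulr.
  rewrite (subst _ (measurable_funepos mEf) (fun z => funepos_ge0 _ _)).
  by congr (_ * _)%E; apply: eq_integral => z _; rewrite !funeposE maxe_mulr.
have negE : (\int[leb]_z F^\- z = M%:R%:E * \int[leb]_z G^\- z)%E.
  transitivity (\int[leb]_z ((EFin \o f)^\- z * (V (normc z))%:E))%E.
    by apply: eq_integral => z _; rewrite !funenegE -!EFinN -mulNr maxe_mulr.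
  rewrite (subst _ (measurable_funeneg mEf) (fun z => funeneg_ge0 _ _)).
  congr (_ * _)%E; apply: eq_integral => z _.
  by rewrite !funenegE -!EFinN -mulNr maxe_mulr.
have aE : a%:E = (\int[leb]_z G^\+ z - \int[leb]_z G^\- z)%E.
  by rewrite -integralE -fa.
rewrite integralE posE negE EFinM aE [RHS]muleBr//.
rewrite fin_num_adde_defl// fin_numN.
exact: (integrable_neg_fin_num measurableT (f := G) If).
Qed.

Lemma has_cintegral_rotation (phi : R) (f : R[i] -> R[i]) a :
  0 <= phi <= pi *+ 2 ->
  has_cintegral leb f a -> has_cintegral leb (fun z => f (polar 1 phi * z)) a.
Proof.
move=> phi2pi [rf jf]; split.
  exact: (has_integral_rotation phi2pi rf).
exact: (has_integral_rotation phi2pi jf).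
Qed.

Lemma has_cintegral_power (M : nat) (V v : R -> R) (f : R[i] -> R[i]) a :
  (0 < M)%N ->
  measurable_fun setT V -> (forall r, 0 <= V r) ->
  measurable_fun setT v -> (forall r, 0 <= v r) ->
  (forall r, 0 < r -> V (r ^+ M) * r ^+ M * r ^+ M.-1 = v r * r) ->
  measurable_fun setT f ->
  has_cintegral leb (fun z => f (z ^+ M) * (v (normc z))%:C%C) a ->
  has_cintegral leb (fun z => f z * (V (normc z))%:C%C) (M%:R * a).
Proof.
move=> M0 mV V0 mv v0 Vv mf [rf jf].
have ReM (z : R[i]) x : complex.Re (z * x%:C%C) = complex.Re z * x.
  by case: z => c d /=; rewrite mulr0 subr0.
have ImM (z : R[i]) x : complex.Im (z * x%:C%C) = complex.Im z * x.
  by case: z => c d /=; rewrite mulr0 add0r.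
have natE : M%:R = (M%:R)%:C%C :> R[i] by rewrite rmorph_nat.
split.
  rewrite natE mulrC ReM mulrC; under eq_fun do rewrite ReM.
  apply: (has_integral_power (f := fun z => complex.Re (f z)) M0 mV V0 mv v0 Vv).
    exact: measurable_funRe.
  by move: rf; congr has_integral; apply/funext => z; rewrite ReM.
rewrite natE mulrC ImM mulrC; under eq_fun do rewrite ImM.
apply: (has_integral_power (f := fun z => complex.Im (f z)) M0 mV V0 mv v0 Vv).
  exact: measurable_funIm.
by move: jf; congr has_integral; apply/funext => z; rewrite ImM.
Qed.

End invariance.

Section gaussian_moments.
Context (R : realType) (N : nat) (N0 : (0 < N)%N).
Local Notation leb := (@lebesgue_complex R).
Local Notation mu := (@lebesgue_measure R).

Let gauss (p : nat) (r : R) := r ^+ p * expR (- (N%:R * r ^+ 2)).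

Let measurable_gauss p : measurable_fun setT (gauss p).
Proof.
apply: measurable_funM; first exact: measurable_funX.
apply: measurableT_comp => //; apply: measurableT_comp => //.
by apply: measurable_funM => //; exact: measurable_funX.
Qed.

(** The exponential series gives [r^p <= p! e^r], and [(r - 1)^2 >= 0] gives
    [N r^2 >= r^2 >= 2 r - 1]. The exponent is thus at most [r - (2 r - 1) = 1 - r]. *)
Let gauss_le p (r : R) : 0 <= r -> gauss p r <= p`!%:R * expR 1 * expR (- r).
Proof.
move=> r0; have rp : r ^+ p <= p`!%:R * expR r.
  case: p => [|p]; first by rewrite expr0 mul1r -expR0 ler_expR.
  have /(le_trans _) := @expR_ge1Dxn R r p r0.
  move=> /(_ (r ^+ p.+1 / p.+1`!%:R)); rewrite lerDr ler01 => /(_ isT).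
  by rewrite ler_pdivrMr ?ltr0n ?fact_gt0// mulrC.
rewrite /gauss (le_trans (ler_wpM2r (expR_ge0 _) rp))// -!mulrA.
rewrite ler_wpM2l// -!expRD ler_expR.
have N1 : 1 <= N%:R :> R by rewrite ler1n.
have : r ^+ 2 <= N%:R * r ^+ 2 by rewrite ler_peMl// sqr_ge0.
have : 0 <= (r - 1) ^+ 2 by exact: sqr_ge0.
rewrite sqrrB1 mulr2n; lra.
Qed.

Lemma integrable_gauss p : leb.-integrable setT
  (EFin \o (fun z => normc z ^+ p * expR (- (N%:R * normc z ^+ 2)))).
Proof.
have mnc : measurable_fun setT (fun z : R[i] => normc z) by exact: measurable_normc.
have mg : measurable_fun setT (EFin \o (fun z : R[i] => gauss p (normc z))).
  by apply/measurable_EFinP; exact: (measurableT_comp (measurable_gauss p)).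
have gauss0 q (r : R) : 0 <= r -> 0 <= gauss q r.
  by move=> r0; rewrite mulr_ge0 ?expR_ge0// exprn_ge0.
have nc0 (z : R[i]) : 0 <= normc z by case: z => a b; exact: sqrtr_ge0.
apply/integrableP; split; first exact: mg.
under eq_integral => z _ do rewrite /= ger0_norm ?gauss0//.
rewrite (ge0_integral_complex_polar mg); last by move=> z; rewrite lee_fin gauss0.
(* After the angular integration only [2 pi r^(p+1) e^(-N r^2)] is left, the extra power of [r]
   being the polar Jacobian. By [gauss_le] it is dominated by a multiple of the exponential density
   of rate 1. *)
have Ik : mu.-integrable `]0, +oo[
    (EFin \o (fun r => pi *+ 2 * gauss p.+1 `|r|)).
  have Ie := integrable_exponential_pdf (@ltr01 R).
  have Ie' : mu.-integrable `]0, +oo[ (EFin \o exponential_pdf (1 : R)).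
    by apply: (integrableS _ _ _ Ie).
  have := integrableZl _ (pi *+ 2 * (p.+1`!%:R * expR 1)) Ie'.
  move=> /(_ (measurable_itv _)).
  apply: le_integrable => //.
    apply/measurable_EFinP; apply: measurable_funTS; apply: measurable_funM => //.
    exact: (measurableT_comp (measurable_gauss _)).
  move=> r /=; rewrite in_itv/= andbT => r0.
  have r0' := ltW r0.
  rewrite exponential_pdfE// lee_fin mul1r mulN1r.
  have pi0 : 0 <= pi *+ 2 :> R by rewrite mulrn_wge0// pi_ge0.
  rewrite (ger0_norm r0') (ger0_norm (mulr_ge0 pi0 (gauss0 _ _ r0'))).
  rewrite [leRHS]ger0_norm; last by rewrite !mulr_ge0 ?expR_ge0.
  by rewrite -[leRHS]mulrA ler_wpM2l// gauss_le.
have /integrableP[_] := Ik; rewrite (_ : (\int[_]_(x in _) _)%E =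
  (\int[mu]_(r in `]0%R, +oo[) \int[mu]_(t in `[0%R, (pi *+ 2)%R[)
    ((gauss p (normc (polar r t)))%:E * `|r|%:E))%E)//.
apply: eq_integral => r rpos.
have {rpos}r0 : 0 < r by have /= := set_mem rpos; rewrite in_itv/= andbT.
under [RHS]eq_integral => t _ do rewrite normc_polar -EFinM.
rewrite (@integral_cst _ _ _ mu _ _ (gauss p `|r| * `|r|)%:E)//=.
have pi0 : 0 < pi *+ 2 :> R by rewrite mulrn_wgt0// pi_gt0.
rewrite lebesgue_measure_itv/= lte_fin pi0 oppr0 adde0 -EFinM.
rewrite /= ger0_norm ?mulr_ge0 ?gauss0 ?(ltW pi0)//; congr _%:E.
by rewrite /gauss exprS; ring.
Qed.

End gaussian_moments.

(** * Roots of unity and vanishing moments *)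

Section roots_of_unity.
Context (R : realType) (M : nat) (M0 : (0 < M)%N).

Let u : R[i] := polar 1 (pi *+ 2 / M%:R).

(** If [cos t = 1], the double angle formula gives [sin (t / 2) = 0], although [t / 2] lies strictly
    between 0 and [pi]. *)
Lemma polar_angle_neq1 (t : R) : 0 < t < pi *+ 2 -> polar 1 t != 1.
Proof.
move=> /andP[t0 t2pi]; apply/eqP => -[]; rewrite mul1r => c1 _.
have s0 : 0 < sin (t / 2).
  apply: sin_gt0_pi; rewrite divr_gt0//= ltr_pdivrMr// mulr_natr//.
have t2 : t / 2 *+ 2 = t by rewrite -[t / 2 *+ 2]mulr_natr divfK.
have := cos2Dsin2 (t / 2); have := cos_mulr2n (t / 2); rewrite t2 c1 => c2 cs.
have : sin (t / 2) ^+ 2 = 0 by move: c2 cs; rewrite mulr2n; lra.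
by move/eqP; rewrite sqrf_eq0 gt_eqF.
Qed.

Lemma polar_root_of_unity : u ^+ M = 1.
Proof.
rewrite /u polarX expr1n mulrCA mulfV ?pnatr_eq0 -?lt0n// mulr1.
by rewrite /polar cos2pi sin2pi mulr0 mulr1.
Qed.

Let u_neq0 : u != 0.
Proof.
apply/eqP => u0; have := polar_root_of_unity; rewrite u0 expr0n -[M == 0%N]negbK -lt0n M0 => /eqP.
by rewrite eq_sym oner_eq0.
Qed.

Lemma primitive_polar i j : u ^+ i = u ^+ j -> i = j %[mod M].
Proof.
have umod k : u ^+ k = u ^+ (k %% M).
  by rewrite {1}(divn_eq k M) exprD mulnC exprM polar_root_of_unity expr1n mul1r.
rewrite umod (umod j) => E.
wlog ij : i j E / (i %% M < j %% M)%N => [H|].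
  case: (ltngtP (i %% M) (j %% M)) => // ij; first exact: H.
  by apply/esym/H.
exfalso; have : u ^+ (j %% M - i %% M) == 1.
  by rewrite -(inj_eq (mulfI (expf_neq0 (i %% M) u_neq0))) -exprD subnKC ?mulr1 ?E// ltnW.
rewrite polarX expr1n (negbTE (polar_angle_neq1 _))//.
set d := (_ - _)%N; have d0 : (0 < d)%N by rewrite subn_gt0.
have dM : (d < M)%N by apply: leq_ltn_trans (ltn_pmod j M0); exact: leq_subr.
have pi0 : 0 < pi *+ 2 :> R by rewrite mulrn_wgt0// pi_gt0.
rewrite mulr_gt0 ?divr_gt0 ?ltr0n//= mulrCA gtr_pMr// ltr_pdivrMr ?ltr0n//.
by rewrite mul1r ltr_nat.
Qed.

(** Replacing [z] by [u z] preserves the integral and multiplies the integrand by [u^i conj(u)^j].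
    If [m] were nonzero this factor would be 1, that is [u^i = u^j] since [|u| = 1]. *)
Lemma rotation_moment_eq0 (h : R[i] -> R) i j m :
  (forall z, h (u * z) = h z) ->
  has_cintegral (@lebesgue_complex R) (fun z => z ^+ i * z^*%C ^+ j * (h z)%:C%C) m ->
  i <> j %[mod M] -> m = 0.
Proof.
move=> hu hm ij.
have phi : 0 <= (pi *+ 2 / M%:R : R) <= pi *+ 2.
  have pi0 : 0 < pi *+ 2 :> R by rewrite mulrn_wgt0// pi_gt0.
  by rewrite divr_ge0 ?(ltW pi0)//= ler_pdivrMr ?ltr0n// ler_peMr ?(ltW pi0)// ler1n.
have E1 := has_cintegral_rotation phi hm.
have E2 := has_cintegralZl (u ^+ i * u^*%C ^+ j) hm.
have E3 : m = u ^+ i * u^*%C ^+ j * m.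
  rewrite -[LHS](has_cintegral_cintegral E1) -[RHS](has_cintegral_cintegral E2).
  congr cintegral; apply/funext => z.
  by rewrite -/u hu rmorphM/= !exprMn; ring.
apply/eqP; apply/negPn/negP => m0; apply: ij; apply: primitive_polar.
have uc : u * u^*%C = 1.
  by rewrite -sqr_normc normc_polar normr1 expr1n.
move/(congr1 (fun x => x / m)): E3; rewrite mulfK// mulfV// => /esym E3.
rewrite -[RHS]mul1r -E3 -mulrA -exprMn [_ * u]mulrC uc expr1n mulr1 //.
Qed.

End roots_of_unity.

Section moments.
Context (R : realType) (M N : nat) (M0 : (0 < M)%N) (N0 : (0 < N)%N).
Local Notation leb := (@lebesgue_complex R).
Variables (g : R[i] -> R) (C : R).
Hypotheses (mg : measurable_fun setT g) (g0 : forall z, 0 <= g z).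
Hypothesis gC : forall z, g z <= C.

(** The test function [g] sees [z] only through [z^M], which makes the weight invariant under
    multiplication by [M]-th roots of unity. *)
Definition gin_weight (z : R[i]) : R :=
  g (z ^+ M) * expR (- (N%:R * normc z ^+ 2)).

Definition gin_moment i j : R[i] :=
  cintegral leb (fun z => z ^+ i * z^*%C ^+ j * (gin_weight z)%:C%C).

Let mnormc : measurable_fun setT (fun z : R[i] => normc z).
Proof. exact: measurable_normc. Qed.

Let mexp : measurable_fun setT (fun r : R => expR (- (N%:R * r ^+ 2))).
Proof.
apply: measurableT_comp => //; apply: measurableT_comp => //.
by apply: measurable_funM => //; exact: measurable_funX.
Qed.

Lemma measurable_gin_weight : measurable_fun setT gin_weight.
Proof.
apply: measurable_funM; last exact: (measurableT_comp mexp).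
by apply: (measurableT_comp mg); exact: measurable_funXc.
Qed.

Let measurable_monomial i j : measurable_fun setT (fun z : R[i] => z ^+ i * z^*%C ^+ j).
Proof.
apply: measurable_funMc; first exact: measurable_funXc.
by apply: measurable_funXc; exact: measurable_conjc.
Qed.

Let normcX (z : R[i]) n : normc (z ^+ n) = normc z ^+ n.
Proof.
elim: n => [|n IH]; first by rewrite !expr0 ComplexField.Normc.normc1.
by rewrite !exprS ComplexField.Normc.normcM IH.
Qed.

Let normc_conj (z : R[i]) : normc z^*%C = normc z.
Proof. by case: z => a b; rewrite /= sqrrN. Qed.

Let normc_ge0 (z : R[i]) : 0 <= normc z.
Proof. by case: z => a b; exact: sqrtr_ge0. Qed.

Let normc_real (x : R) : normc x%:C%C = `|x|.
Proof. by rewrite /= expr0n addr0 sqrtr_sqr. Qed.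

Lemma has_gin_moment i j : has_cintegral leb
  (fun z => z ^+ i * z^*%C ^+ j * (gin_weight z)%:C%C) (gin_moment i j).
Proof.
apply: (@has_cintegral_dominated _ _ _ _ _ (fun z =>
    C * (normc z ^+ (i + j) * expR (- (N%:R * normc z ^+ 2))))).
- apply: measurable_funMc => //.
  by apply: measurable_real_complex; exact: measurable_gin_weight.
- by have := integrableZl measurableT C (integrable_gauss R N0 (i + j)).
- move=> z; rewrite !ComplexField.Normc.normcM !normcX normc_conj -exprD.
  rewrite normc_real ger0_norm ?mulr_ge0 ?expR_ge0// mulrCA.
  by rewrite ler_wpM2r// mulr_ge0 ?exprn_ge0 ?expR_ge0.
Qed.

Lemma gin_moment_eq0 i j : i <> j %[mod M] -> gin_moment i j = 0.
Proof.
move=> ij; apply: (rotation_moment_eq0 M0 _ (has_gin_moment i j)) => // z.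
rewrite /gin_weight exprMn (polar_root_of_unity R M0) mul1r.
rewrite ComplexField.Normc.normcM normc_polar.
by rewrite normr1 mul1r.
Qed.

(** Here [k] counts from 0, so that it can range over ['I_M]; the exponent is the one of the class
    labelled [k.+1]. *)
Definition power_weight k (z : R[i]) : R :=
  g z * (normc z `^ (2 * (k.+1%:R - M%:R) / M%:R) *
         expR (- (N%:R * normc z `^ (2 / M%:R)))).

Lemma measurable_power_weight k : measurable_fun setT (power_weight k).
Proof.
apply: measurable_funM => //.
apply: measurable_funM; first exact: (measurableT_comp (measurable_powR _)).
apply: measurableT_comp => //; apply: measurableT_comp => //.
by apply: measurable_funM => //; exact: (measurableT_comp (measurable_powR _)).
Qed.

(** Pulled back along [w = z^M], the radial density of the class becomes [|z|^(2k) e^(-N |z|^2)],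
    and [|z|^(2k) = z^k conj(z)^k] shifts both exponents [M a] and [M b] by [k]. *)
Lemma has_power_moment k a b : has_cintegral leb
  (fun z => z ^+ a * z^*%C ^+ b * (power_weight k z)%:C%C)
  (M%:R * gin_moment (k + M * a) (k + M * b)).
Proof.
pose V (r : R) := r `^ (2 * (k.+1%:R - M%:R) / M%:R) * expR (- (N%:R * r `^ (2 / M%:R))).
pose v (r : R) := (r ^+ 2) ^+ k * expR (- (N%:R * r ^+ 2)).
apply: (@eq_has_cintegral _ _ _ leb (fun z : R[i] =>
    (z ^+ a * z^*%C ^+ b * (g z)%:C%C) * (V (normc z))%:C%C)).
  by move=> z; rewrite -mulrA -rmorphM.
apply: (@has_cintegral_power R M V v) => //.
- apply: measurable_funM; first exact: measurable_powR.
  apply: measurableT_comp => //; apply: measurableT_comp => //.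
  by apply: measurable_funM => //; exact: measurable_powR.
- by move=> r; rewrite mulr_ge0 ?powR_ge0 ?expR_ge0.
- by apply: measurable_funM => //; do 2 apply: measurable_funX.
- by move=> r; rewrite mulr_ge0 ?expR_ge0// exprn_ge0// sqr_ge0.
(* Count of exponents: [2 (k + 1 - M)] from [V (r^M)], plus [M] and [M - 1], makes [2 k + 1], as in
   [v r * r]. *)
- move=> r r0; have r0' := ltW r0; have rn0 := lt0r_neq0 r0.
  have Mn0 : M%:R != 0 :> R by rewrite pnatr_eq0 -lt0n.
  have E x : (r ^+ M) `^ (x / M%:R) = r `^ x.
    by rewrite -powR_mulrn// -powRrM mulrCA mulfV// mulr1.
  have E2 : r `^ (2 * (k.+1%:R - M%:R)) = r ^+ (2 * k.+1) / (r ^+ M) ^+ 2.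
    rewrite mulrBr powRB ?rn0 ?implybT// -!natrM !powR_mulrn//.
    by rewrite (mulnC 2 M) [r ^+ (M * 2)]exprM.
  rewrite /V /v !E E2 (@powR_mulrn _ r 2)//.
  have Ar : r ^+ M = r * r ^+ M.-1 by rewrite -exprS prednK.
  rewrite Ar mulnS exprD exprM.
  have : r ^+ M.-1 != 0 by rewrite expf_neq0.
  move: (expR _) ((r ^+ 2) ^+ k) (r ^+ M.-1) => e q B Bn0.
  by field; rewrite Bn0 rn0.
- apply: measurable_funMc => //; exact: measurable_real_complex.
apply: eq_has_cintegral (has_gin_moment (k + M * a) (k + M * b)) => z.
rewrite !exprD !exprM rmorphXn/= /gin_weight /v.
rewrite !rmorphM/= rmorphXn/= sqr_normc exprMn; ring.
Qed.

End moments.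

(** * Enumeration of the residue classes *)

Section residue_classes.
Variables (N M : nat) (M0 : (0 < M)%N) (MN : (M <= N)%N).

Lemma mem_residue_class (k : 'I_M) (i : 'I_N) :
  (i \in residue_class N M k.+1) = (i %% M == k)%N.
Proof. by rewrite inE -!(add1n i) -(add1n k) eqn_modDl [(k %% M)%N]modn_small. Qed.

(** Number of [a] with [k + M a <= N - 1]. The subtraction does not truncate, since [k < M <= N]. *)
Let card (k : nat) := ((N - k.+1) %/ M).+1.

Let enum_residue_subproof (k : 'I_M) (a : 'I_(card k)) : (k + M * a < N)%N.
Proof.
have : (a * M <= N - k.+1)%N by rewrite -leq_divRL// -ltnS.
by have := ltn_ord k; rewrite mulnC; lia.
Qed.

Let enum_res (k : 'I_M) (a : 'I_(card k)) : 'I_N := Ordinal (enum_residue_subproof a).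

Let enum_res_inj k : injective (@enum_res k).
Proof.
move=> a b /(congr1 val)/= /eqP; rewrite eqn_add2l eqn_pmul2l// => /eqP ab.
exact: val_inj.
Qed.

Let enum_resP (k : 'I_M) (i : 'I_N) :
  reflect (exists a, i = enum_res (k := k) a) (i \in residue_class N M k.+1).
Proof.
rewrite mem_residue_class; apply: (iffP eqP) => [ik|[a ->]]; last first.
  by rewrite /= mulnC addnC modnMDl modn_small.
have ic : (i %/ M < card k)%N.
  rewrite ltnS leq_divRL//; have := divn_eq i M; have := ltn_ord i; lia.
exists (Ordinal ic); apply: val_inj => /=; rewrite {1}(divn_eq i M) ik addnC.
by rewrite mulnC.
Qed.

Let card_residue (k : 'I_M) : #|residue_class N M k.+1| = card k.
Proof.
rewrite -[RHS](card_ord (card k)) -(card_imset _ (@enum_res_inj k)).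
apply: eq_card => i; apply/enum_resP/imsetP => [[a ->]|[a _ ->]]; by exists a.
Qed.

(** The map [a |-> k + M a], cast to be indexed by the cardinality that occurs in [Gin_power]. *)
Definition enum_residue (k : 'I_M) (a : 'I_#|residue_class N M k.+1|) : 'I_N :=
  enum_res (cast_ord (card_residue k) a).

Lemma enum_residue_inj k : injective (@enum_residue k).
Proof. by move=> a b /enum_res_inj/cast_ord_inj. Qed.

Definition residue (i : 'I_N) : 'I_M := Ordinal (ltn_pmod i M0).

Lemma codom_enum_residue k i : (i \in codom (@enum_residue k)) = (residue i == k).
Proof.
have -> : (residue i == k) = (i \in residue_class N M k.+1) by rewrite mem_residue_class.
apply/codomP/enum_resP => [[a ->]|[a ->]]; first by eexists.
by exists (cast_ord (esym (card_residue k)) a); rewrite /enum_residue cast_ordKV.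
Qed.

End residue_classes.

(** * Factorization of the Ginibre integral over residue classes *)

Section factorization.
Context (R : realType) (M N : nat) (M0 : (0 < M)%N) (MN : (M <= N)%N).
Local Notation leb := (@lebesgue_complex R).
Variables (g : R[i] -> R) (C : R).
Hypotheses (mg : measurable_fun setT g) (g0 : forall z, 0 <= g z).
Hypothesis gC : forall z, g z <= C.

Let n (k : 'I_M) := #|residue_class N M k.+1|.

Definition gin_integral : R :=
  \int[tuple_measure leb N]_z (sq_vandermonde z * \prod_i gin_weight M N g (tnth z i)).

Definition power_integral (k : 'I_M) : R :=
  \int[tuple_measure leb (n k)]_z
    (sq_vandermonde z * \prod_i power_weight M N g k (tnth z i)).

Let N0 : (0 < N)%N := leq_trans M0 MN.

Let has_gin : has_cintegral (tuple_measure leb N)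
    (fun z => (sq_vandermonde z * \prod_i gin_weight M N g (tnth z i))%:C%C)
    (N`!%:R * \det (\matrix_(i < N, j < N) gin_moment M N g i j)).
Proof.
apply: andreief; first exact: measurable_gin_weight.
by move=> i j _ _; exact: has_gin_moment.
Qed.

Let has_power k : has_cintegral (tuple_measure leb (n k))
    (fun z => (sq_vandermonde z * \prod_i power_weight M N g k (tnth z i))%:C%C)
    ((n k)`!%:R * \det (\matrix_(a < n k, b < n k)
        (M%:R * gin_moment M N g (k + M * a) (k + M * b)))).
Proof.
apply: (andreief (m := fun a b => M%:R * gin_moment M N g (k + M * a) (k + M * b))).
  exact: measurable_power_weight.
by move=> i j _ _; exact: has_power_moment.
Qed.

Lemma has_gin_integral : has_integral (tuple_measure leb N)
  (fun z => sq_vandermonde z * \prod_i gin_weight M N g (tnth z i)) gin_integral.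
Proof. by have [[If _] _] := has_gin; exact: has_integralP. Qed.

Lemma has_power_integral k : has_integral (tuple_measure leb (n k))
  (fun z => sq_vandermonde z * \prod_i power_weight M N g k (tnth z i))
  (power_integral k).
Proof. by have [[If _] _] := has_power k; exact: has_integralP. Qed.

(** By [andreief] the left integral is [N!] times a determinant that splits over the residue
    classes, and the class of [k] has the integral [n_k! M^(n_k)] times its block; the power of [M]
    comes from the factor [M] in each moment. The form without division holds whether or not the
    integrals vanish, and its constants do not involve [g]. *)
Lemma gin_integral_factor :
  gin_integral * \prod_k ((n k)`!%:R * M%:R ^+ n k) =
  N`!%:R * \prod_k power_integral k.
Proof.
have CE m (f : m.-tuple R[i] -> R) a :
    has_cintegral (tuple_measure leb m) (fun z => (f z)%:C%C) a ->
    (\int[tuple_measure leb m]_z f z)%:C%C = a.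
  move=> fa; rewrite -(has_cintegral_cintegral fa) /cintegral/= .
  by congr (_ +i* _)%C; rewrite /Rintegral integral0.
apply: (@complexI R).
rewrite !rmorphM/= !rmorph_prod/= rmorph_nat (CE _ _ _ has_gin).
under [in RHS]eq_bigr => k _ do rewrite (CE _ _ _ (has_power k)).
rewrite (@det_blocks _ _ _ (residue M0) n (@enum_residue N M M0 MN)); last 3 first.
- exact: enum_residue_inj.
- exact: codom_enum_residue.
- move=> i j ij; rewrite mxE (gin_moment_eq0 M0 N0 mg g0 gC)// => /eqP E; case/negP: ij.
  by apply/eqP/val_inj/eqP.
rewrite -mulrA -big_split/=; congr (_ * _); apply: eq_bigr => k _.
rewrite (_ : \matrix_(a, b) _ = M%:R *: mxsub (enum_residue M0 MN (k := k))
   (enum_residue M0 MN (k := k)) (\matrix_(i < N, j < N) gin_moment M N g i j)).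
  rewrite detZ rmorphM rmorphXn/= !rmorph_nat; ring.
by apply/matrixP => a b; rewrite !mxE.
Qed.

End factorization.

(** * Counting statistics and generating functions *)

Section totals.
Context d (T : measurableType d).

Definition total_count (c : T -> nat) (s : config T) : nat :=
  (\sum_(x <- enum_mset s) c x)%N.

Lemma total_count_seq_mset (c : T -> nat) (l : seq T) :
  total_count c (seq_mset l) = (\sum_(x <- l) c x)%N.
Proof. by rewrite /total_count; apply: perm_big; exact: perm_eq_seq_mset. Qed.

Lemma total_count_msetD (c : T -> nat) (s t : config T) :
  total_count c (msetD s t) = (total_count c s + total_count c t)%N.
Proof.
rewrite /total_count -big_cat; apply: perm_big; apply/eq_seq_msetP.
rewrite seq_mset_id; apply/msetP => a.
by rewrite mset_seqE count_cat !count_mem_mset msetE2.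
Qed.

Lemma total_count_mset0 (c : T -> nat) : total_count c mset0 = 0%N.
Proof. by rewrite /total_count enum_mset0 big_nil. Qed.

Lemma points_inE (B : set T) (s : config T) :
  points_in B s = total_count (fun x => nat_of_bool (x \in B)) s.
Proof. by rewrite /total_count /points_in -sum1_count big_mkcond. Qed.

(* Summed over a configuration, this gives the number whose digits in base [D]
   are the numbers of points in the sets of [Bs] (if these are less than [D]),
   so that a single integer encodes all the counts. *)
Fixpoint digits (D : nat) (Bs : seq (set T)) (x : T) : nat :=
  if Bs is B :: Bs' then ((x \in B) + D * digits D Bs' x)%N else 0%N.

Lemma total_count_digits_cons D B Bs s :
  total_count (digits D (B :: Bs)) s = (points_in B s + D * total_count (digits D Bs) s)%N.
Proof. by rewrite points_inE /total_count/= big_split/= big_distrr. Qed.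

Lemma total_count_digits_nil D s : total_count (digits D [::]) s = 0%N.
Proof. by rewrite /total_count big1. Qed.

Context (R : realType).

Lemma measurable_digits D (Bs : seq (set T)) :
  (forall B, List.In B Bs -> measurable B) ->
  measurable_fun setT (fun x => (digits D Bs x)%:R : R).
Proof.
elim: Bs => [|B Bs IH] mB; first exact: measurable_cst.
under eq_fun do rewrite /= natrD natrM.
apply: measurable_funD.
  rewrite (_ : (fun x => _) = \1_B :> (T -> R)) //.
  by apply: measurable_indic; apply: mB; left.
apply: measurable_funM => //; apply: IH => A AB; apply: mB; right => //.
Qed.

Lemma digits_bounded D (Bs : seq (set T)) : exists b, forall x, (digits D Bs x <= b)%N.
Proof.
elim: Bs => [|B Bs [b IH]]; first by exists 0%N.
exists (1 + D * b)%N => x /=; apply: leq_add; first by case: (_ \in _).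
by rewrite leq_mul2l IH orbT.
Qed.

Lemma measurable_points_in (B : set T) : measurable B ->
  measurable_fun setT (fun s : config T => (points_in B s)%:R : R).
Proof.
move=> mB _ A mA; rewrite setTI.
rewrite (_ : _ @^-1` _ = \bigcup_(n in [set n | A n%:R]) [set s | points_in B s = n]).
  apply: bigcup_measurable => n _; apply: sub_sigma_algebra.
  by exists B => //; exists n.
apply/seteqP; split => [s /= As|s [n /= An En]]; last by rewrite /= En.
by exists (points_in B s).
Qed.

Lemma measurable_total_count_digits D (Bs : seq (set T)) :
  (forall B, List.In B Bs -> measurable B) ->
  measurable_fun setT (fun s : config T => (total_count (digits D Bs) s)%:R : R).
Proof.
elim: Bs => [|B Bs IH] mB.
  by under eq_fun do rewrite total_count_digits_nil; exact: measurable_cst.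
under eq_fun do rewrite total_count_digits_cons natrD natrM.
apply: measurable_funD; first by apply: measurable_points_in; apply: mB; left.
apply: measurable_funM => //; apply: IH => A AB; apply: mB; right => //.
Qed.

Lemma measurable_total_count_digits_eq D (Bs : seq (set T)) n :
  (forall B, List.In B Bs -> measurable B) ->
  measurable [set s : config T | total_count (digits D Bs) s = n].
Proof.
move=> mB; have := measurable_total_count_digits D mB.
move=> /(_ measurableT [set n%:R] (measurable_set1 _)); rewrite setTI.
congr measurable; apply/seteqP; split => s /=.
  by move=> /eqP; rewrite eqr_nat => /eqP.
by move=> ->.
Qed.

End totals.

Lemma measurable_prodr d (T : measurableType d) (R : realType) (I : Type)
    (r : seq I) (P : pred I) (h : I -> T -> R) :
  (forall i, P i -> measurable_fun setT (h i)) ->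
  measurable_fun setT (fun x => \prod_(i <- r | P i) h i x).
Proof.
move=> mh; elim: r => [|i r IH].
  by under eq_fun do rewrite big_nil; exact: measurable_cst.
under eq_fun do rewrite big_cons.
by case Pi: (P i) => //; apply: measurable_funM => //; exact: mh.
Qed.

Lemma total_count_power_config (R : realType) (c : R[i] -> nat) M (s : config R[i]) :
  total_count c (power_config M s) = total_count (fun z : R[i] => c (z ^+ M)) s.
Proof. by rewrite total_count_seq_mset big_map. Qed.

Lemma total_count_union_config (R : realType) (c : R[i] -> nat) (I : finType)
    (s : I -> config R[i]) :
  total_count c (union_config s) = (\sum_i total_count c (s i))%N.
Proof. exact: (big_morph _ (total_count_msetD c) (total_count_mset0 c)). Qed.

Section generating_function.
Context (R : realType) (n : nat).
Local Notation leb := (@lebesgue_complex R).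
Variables (w : R[i] -> R) (c : R[i] -> nat) (t : R) (b K : nat).
Hypotheses (mw : measurable_fun setT w) (w0 : forall z, 0 <= w z).
Hypotheses (mc : measurable_fun setT (fun z => (c z)%:R : R)).
Hypotheses (cb : forall z, (c z <= b)%N) (nbK : (n * b < K)%N) (t0 : 0 <= t).

Let f (z : n.-tuple R[i]) := sq_vandermonde z * \prod_i w (tnth z i).

Lemma sq_vandermonde_ge0 (z : n.-tuple R[i]) : 0 <= sq_vandermonde z.
Proof. by apply: prodr_ge0 => i _; apply: prodr_ge0 => j _; exact: sqr_ge0. Qed.

Lemma measurable_tuple_prod (h : R[i] -> R) : measurable_fun setT h ->
  measurable_fun setT (fun z : n.-tuple R[i] => \prod_i h (tnth z i)).
Proof.
move=> mh; apply: measurable_prodr => i _.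
exact: (measurableT_comp mh (measurable_tnth i)).
Qed.

Lemma measurable_sq_vandermonde : measurable_fun setT (@sq_vandermonde R n).
Proof.
apply: measurable_prodr => i _; apply: measurable_prodr => j _.
apply: measurable_funX; apply: measurable_normc.
by apply: measurable_funBc; exact: measurable_tnth.
Qed.

Let mf : measurable_fun setT f.
Proof.
by apply: measurable_funM; [exact: measurable_sq_vandermonde|exact: measurable_tuple_prod].
Qed.

Let f0 z : 0 <= f z.
Proof. by rewrite mulr_ge0 ?sq_vandermonde_ge0// prodr_ge0. Qed.

Let X (z : n.-tuple R[i]) := (\sum_i c (tnth z i))%N.

Let totalX z : total_count c (seq_mset (tval z)) = X z.
Proof. by rewrite total_count_seq_mset big_tuple. Qed.

Let mX : measurable_fun setT (fun z => (X z)%:R : R).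
Proof.
rewrite /X; elim: (index_enum _) => [|i r IH].
  by under eq_fun do rewrite big_nil; exact: measurable_cst.
under eq_fun do rewrite big_cons natrD.
by apply: measurable_funD => //; exact: (measurableT_comp mc (measurable_tnth i)).
Qed.

Let mXm m : measurable [set z | X z = m].
Proof.
have := mX measurableT (measurable_set1 m%:R); rewrite setTI.
congr measurable; apply/seteqP; split => s /=.
  by move=> /eqP; rewrite eqr_nat => /eqP.
by move=> ->.
Qed.

(** On the event that the total is [m], the factor [t^m] is the product of the [t^(c z_i)]. The
    total is at most [n * b < K], so these finitely many events cover everything. *)
Lemma generating_function (a a' : R) :
  has_integral (tuple_measure leb n) f a ->
  has_integral (tuple_measure leb n)
    (fun z => sq_vandermonde z * \prod_i (t ^+ c (tnth z i) * w (tnth z i))) a' ->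
  (\sum_(m < K) (t ^+ m)%:E * unordered_law f [set s | total_count c s = m] =
   (a^-1 * a')%:E)%E.
Proof.
move=> [_ fa] [_ fa'].
rewrite /unordered_law /normalization fa/=.
under eq_bigr => m _ do rewrite muleCA.
rewrite -ge0_sume_distrr; last first.
  move=> m _; rewrite mule_ge0 ?lee_fin ?exprn_ge0//.
  by apply: integral_ge0 => z _; rewrite lee_fin.
rewrite EFinM -fa'; congr (_ * _)%E.
have mg m : measurable_fun setT (fun z => t ^+ m * (f z * (X z == m)%:R)).
  apply: measurable_funM => //; apply: measurable_funM => //.
  rewrite (_ : (fun z => _) = \1_[set z | X z = m] :> (n.-tuple R[i] -> R)).
    exact: measurable_indic.
  apply/funext => z; rewrite indicE; congr (nat_of_bool _)%:R.
  by apply/eqP/idP => [?|/set_mem//]; apply/mem_set.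
have g0 m z : 0 <= t ^+ m * (f z * (X z == m)%:R).
  by rewrite mulr_ge0 ?exprn_ge0// mulr_ge0.
transitivity (\sum_(m < K) \int[tuple_measure leb n]_z
    (t ^+ m * (f z * (X z == m)%:R))%:E)%E.
  apply: eq_bigr => m _; rewrite integral_mkcond -ge0_integralZl//; last 3 first.
  - apply/(measurable_restrictT _ _).1; last first.
      exact/measurable_EFinP/measurable_funTS.
    by under eq_set do rewrite totalX.
  - by move=> z _; rewrite patchE; case: ifPn; rewrite ?lee_fin.
  - by rewrite lee_fin exprn_ge0.
  apply: eq_integral => z _; rewrite patchE [RHS]EFinM; congr (_ * _)%E.
  case: ifPn => [/set_mem/=|/negP zm].
    by rewrite totalX => ->; rewrite eqxx mulr1.
  case: eqP => [E|_]; last by rewrite mulr0.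
  by exfalso; apply: zm; apply/mem_set; rewrite /= totalX.
rewrite -ge0_integral_sum//; last 2 first.
- by move=> m; exact/measurable_EFinP.
- by move=> m z _; rewrite lee_fin.
apply: eq_integral => z _; rewrite sumEFin; congr _%:E.
have XK : (X z < K)%N.
  apply: leq_ltn_trans nbK; rewrite -[n in (n * b)%N]card_ord -sum_nat_const.
  exact: leq_sum.
rewrite (bigD1 (Ordinal XK))//= eqxx mulr1 big1 ?addr0 => [|m neq_mX].
  by rewrite big_split/= prodrXr mulrCA.
case: eqP => E; last by rewrite !mulr0.
by case/eqP: neq_mX; exact: val_inj.
Qed.

End generating_function.

Lemma measure_bigcup_fin d (T : measurableType d) (R : realType)
    (mu : {measure set T -> \bar R}) (I : finType) (Q : pred I) (F : I -> set T) :
  (forall i, measurable (F i)) -> trivIset setT F ->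
  mu (\bigcup_(i in [set` Q]) F i) = (\sum_(i | Q i) mu (F i))%E.
Proof.
move=> mF tF; have -> : [set` Q] = [set` enum Q].
  by apply/seteqP; split => i /=; rewrite mem_enum.
rewrite measure_fin_bigcup//; last exact: sub_trivIset tF.
by rewrite -fsbig_seq ?enum_uniq// big_enum.
Qed.

(** Positive integers suffice as evaluation points, and being at least 1 they keep [t^c] below [t^b]
    when [c <= b]. *)
Lemma poly_eq_nat (R : numDomainType) (p q : {poly R}) :
  (forall m : nat, p.[m.+1%:R] = q.[m.+1%:R]) -> p = q.
Proof.
move=> pq; apply/eqP; rewrite -subr_eq0; apply/negPn/negP => pq0.
(* As many distinct roots as the size of [p - q], one more than its degree allows. *)
pose rs := [seq i.+1%:R : R | i <- iota 0 (size (p - q))].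
have := @max_poly_roots _ _ rs pq0; rewrite size_map size_iota ltnn => absurd.
suff : false by []; apply: absurd.
  by apply/allP => _ /mapP[i _ ->]; rewrite rootE !hornerE pq subrr.
rewrite map_inj_uniq ?iota_uniq// => i j /eqP.
by rewrite eqr_nat => /eqP[].
Qed.

(** * Sums of independent counts *)

Section independent_sum.
Context (R : realType) d d' (T : measurableType d) (T' : measurableType d').
Context (P : probability T R) (I : finType) (X : I -> {RV P >-> T'}).
Hypothesis indep : mutually_independent X.
Variable Y : T' -> nat.
Hypothesis mY : forall n, measurable [set x | Y x = n].

Let law (k : I) (n : nat) := fine (P (X k @^-1` [set x | Y x = n])).

Let mXY k n : measurable (X k @^-1` [set x | Y x = n]).
Proof.
by rewrite -[X in measurable X]setTI; exact: (measurable_funP (X k)).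
Qed.

(** The product of polynomials expands over all families of values below [K]; independence makes
    each term the probability of one joint event. If the sum is [n], every summand is at most
    [n < K], so the truncation loses nothing at degree [n]. *)
Lemma independent_sum n K : (n < K)%N ->
  fine (P [set w | (\sum_k Y (X k w))%N = n]) =
  (\prod_k \poly_(m < K) law k m)`_n.
Proof.
move=> nK.
under eq_bigr do rewrite poly_def.
rewrite (bigA_distr_bigA (fun k (m : 'I_K) => law k m *: 'X^m)) coef_sum.
pose A (f : {ffun I -> 'I_K}) := \bigcap_(k in [set` [set: I]%SET])
  X k @^-1` [set x | Y x = f k].
have AE1 f w : A f w -> forall k, Y (X k w) = f k.
  by move=> Afw k; apply: Afw; rewrite /= inE.
have AE2 (f : {ffun I -> 'I_K}) w : (forall k, Y (X k w) = f k) -> A f w.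
  by move=> Yf k _; exact: Yf.
have -> : [set w | (\sum_k Y (X k w))%N = n] =
    \bigcup_(f in [set` [pred f : {ffun I -> 'I_K} | (\sum_k f k)%N == n]]) A f.
  apply/seteqP; split => w /=.
    move=> Yn; have YK k : (Y (X k w) < K)%N.
      by apply: leq_ltn_trans nK; rewrite -Yn (bigD1 k)//= leq_addr.
    exists [ffun k => Ordinal (YK k)]; last by apply: AE2 => k; rewrite ffunE.
    by rewrite /= inE -Yn; apply/eqP/eq_bigr => k _; rewrite ffunE.
  move=> [f /eqP fn /AE1 Yf]; rewrite -fn.
  by apply: eq_bigr => k _; rewrite Yf.
have mA f : measurable (A f).
  by apply: fin_bigcap_measurable => // k _; exact: mXY.
rewrite measure_bigcup_fin//; last first.
  move=> f g _ _ [w [/AE1 fw /AE1 gw]]; apply/ffunP => k; apply: val_inj.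
  by rewrite /= -fw -gw.
have PA f : P (A f) = (\prod_k law k (f k))%:E.
  rewrite /A (indep (A := fun k => [set x | Y x = f k]))//.
  rewrite -prodEFin; apply: eq_big => [k|k _]; first by rewrite inE.
  by rewrite /law fineK// fin_num_measure.
rewrite (eq_bigr _ (fun f _ => PA f)) sumEFin/= big_mkcond; apply: eq_bigr => f _.
rewrite scaler_prod prodrXr coefZ coefXn /= [n == _]eq_sym.
by case: eqP => _; rewrite ?mulr0 ?mulr1.
Qed.

End independent_sum.

Lemma law_generating_poly (R : realType) n d (T : measurableType d)
    (P : probability T R) (X : {RV P >-> config R[i]}) (f : n.-tuple R[i] -> R)
    (w : R[i] -> R) (c : R[i] -> nat) (t : R) (b K : nat) (a a' : R) :
  has_law P X (unordered_law f) ->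
  (forall z, f z = sq_vandermonde z * \prod_i w (tnth z i)) ->
  measurable_fun setT w -> (forall z, 0 <= w z) ->
  measurable_fun setT (fun z => (c z)%:R : R) ->
  (forall m, measurable [set s : config R[i] | total_count c s = m]) ->
  (forall z, (c z <= b)%N) -> (n * b < K)%N -> 0 <= t ->
  has_integral (tuple_measure (@lebesgue_complex R) n)
    (fun z => sq_vandermonde z * \prod_i w (tnth z i)) a ->
  has_integral (tuple_measure (@lebesgue_complex R) n)
    (fun z => sq_vandermonde z * \prod_i (t ^+ c (tnth z i) * w (tnth z i))) a' ->
  a != 0 /\
  (\poly_(m < K) fine (P (X @^-1` [set s | total_count c s = m]))).[t] = a^-1 * a'.
Proof.
move=> Xlaw /funext fE mw w0 mc mtot cb nbK t0 fa fa'; split.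
  (* Since [0^-1 = 0], a vanishing normalization would give the law total mass 0, whereas [X] is a
     random variable under a probability. *)
  apply/eqP => a0; have := Xlaw setT measurableT.
  rewrite preimage_setT probability_setT /unordered_law /normalization fE.
  have [_ ->] := fa; rewrite a0 /= invr0 mul0e => /eqP.
  by rewrite onee_eq0.
apply: EFin_inj; rewrite -(generating_function mw w0 mc cb nbK t0 fa fa').
rewrite horner_poly -sumEFin; apply: eq_bigr => m _.
rewrite mulrC EFinM; congr (_ * _)%E.
rewrite fineK; first by rewrite Xlaw// fE.
apply: fin_num_measure; rewrite -[X in measurable X]setTI.
exact: (measurable_funP X).
Qed.

(** * Equality in law of the encoded counts *)

Section total_count_laws.
Context (R : realType) (M N : nat) (M0 : (0 < M)%N) (MN : (M <= N)%N).
Context (d1 : measure_display) (T1 : measurableType d1) (P1 : probability T1 R).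
Context (L : {RV P1 >-> config R[i]}) (L_law : has_law P1 L (Gin N)).
Context (d2 : measure_display) (T2 : measurableType d2) (P2 : probability T2 R).
Context (G : 'I_M -> {RV P2 >-> config R[i]}).
Hypothesis G_law : forall k : 'I_M, has_law P2 (G k) (Gin_power N M k.+1).
Hypothesis G_indep : mutually_independent G.
Variables (D : nat) (Bs : seq (set R[i])).
Hypothesis mBs : forall B, List.In B Bs -> measurable B.

Let c := digits D Bs.

Let Bs' := [seq (fun z : R[i] => z ^+ M) @^-1` B | B <- Bs].

Let digits_power z : digits D Bs' z = c (z ^+ M).
Proof.
by rewrite /Bs' /c; elim: (Bs) => //= B Bs0 ->; congr (nat_of_bool _ + _)%N.
Qed.

Let mBs' B : List.In B Bs' -> measurable B.
Proof.
have mpow : measurable_fun setT (fun z : R[i] => z ^+ M) by exact: measurable_funXc.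
rewrite /Bs'; elim: (Bs) mBs => //= A As IH mAs [<-|BAs].
  by rewrite -[X in measurable X]setTI; apply: mpow => //; apply: mAs; left.
by apply: IH => // C CAs; apply: mAs; right.
Qed.

Lemma total_count_law_eq n :
  fine (P1 [set w | total_count c (power_config M (L w)) = n]) =
  fine (P2 [set w | total_count c (union_config (fun k => G k w)) = n]).
Proof.
have [b cb] := digits_bounded D Bs.
(* Above [n], so that the coefficient of degree [n] survives truncation, and above [N * b], which
   bounds the totals of [L] and of every class. *)
pose K := (n + N * b).+1.
have mc := @measurable_digits _ _ R D _ mBs.
have mc' := @measurable_digits _ _ R D _ mBs'.
have mt m := @measurable_total_count_digits_eq _ _ R D _ m mBs.
have mt' m := @measurable_total_count_digits_eq _ _ R D _ m mBs'.
have leK k : (#|residue_class N M k| * b < K)%N.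
  rewrite ltnS (leq_trans _ (leq_addl n _))// leq_mul2r.
  by rewrite -[X in (_ <= X)%N]card_ord max_card orbT.
have NK : (N * b < K)%N by rewrite ltnS leq_addl.
pose p1 := \poly_(m < K) fine (P1 (L @^-1` [set s | total_count (digits D Bs') s = m])).
pose p2 k := \poly_(m < K) fine (P2 (G k @^-1` [set s | total_count c s = m])).
have -> : fine (P1 [set w | total_count c (power_config M (L w)) = n]) = p1`_n.
  rewrite coef_poly ifT; last by rewrite ltnS leq_addr.
  congr (fine (P1 _)); apply/funext => w /=.
  by rewrite /mkset /preimage/= total_count_power_config (funext digits_power).
have -> : fine (P2 [set w | total_count c (union_config (fun k => G k w)) = n]) =
    (\prod_k p2 k)`_n.
  have nK : (n < K)%N by rewrite ltnS leq_addr.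
  have := independent_sum G_indep (Y := total_count c) mt nK.
  move=> <-; congr (fine (P2 _)).
  by apply/seteqP; split => w /=; rewrite total_count_union_config.
suff -> : p1 = \prod_k p2 k by [].
apply: poly_eq_nat => m.
set t : R := m.+1%:R.
have t1 : 1 <= t by rewrite ler1n.
have t0 : 0 <= t by rewrite ler0n.
pose g (z : R[i]) : R := t ^+ c z.
have g0 z : 0 <= g z by rewrite exprn_ge0.
have gb z : g z <= t ^+ b by apply: ler_weXn2l => //; exact: cb.
have mg : measurable_fun setT g.
  rewrite (_ : g = fun z => t `^ (c z)%:R); last first.
    by apply/funext => z; rewrite powR_mulrn.
  exact: (measurableT_comp (measurable_powRr t) mc).
(* The constant weight turns the integrals into the normalization constants of the two kinds of
   laws. *)
pose g1 (z : R[i]) : R := 1.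
have g10 z : 0 <= g1 z by [].
have g1b z : g1 z <= 1 by [].
have mg1 : measurable_fun setT g1 by exact: measurable_cst.
have N0 : (0 < N)%N by exact: leq_trans MN.
have [a0 ->] : gin_integral M N g1 != 0 /\
    p1.[t] = (gin_integral M N g1)^-1 * gin_integral M N g.
  apply: (law_generating_poly L_law (w := gin_weight M N g1) (b := b)) => //.
  - move=> z; rewrite /gin_density mulr_sumr -sumrN expR_sum.
    by congr (_ * _); apply: eq_bigr => i _; rewrite /gin_weight mul1r.
  - exact: measurable_gin_weight.
  - by move=> z; rewrite mulr_ge0 ?expR_ge0.
  - by move=> z; rewrite digits_power.
  - exact: (has_gin_integral M0 MN mg1 g10 g1b).
  - have := has_gin_integral M0 MN mg g0 gb.
    congr has_integral; apply/funext => z; congr (_ * _); apply: eq_bigr => i _.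
    by rewrite /gin_weight digits_power mul1r.
have p2E k : power_integral N g1 k != 0 /\
    (p2 k).[t] = (power_integral N g1 k)^-1 * power_integral N g k.
  apply: (law_generating_poly (G_law k) (w := power_weight M N g1 k) (b := b)) => //.
  - by move=> z; congr (_ * _); apply: eq_bigr => i _; rewrite /power_weight mul1r.
  - exact: measurable_power_weight.
  - by move=> z; rewrite !mulr_ge0 ?powR_ge0 ?expR_ge0.
  - exact: (has_power_integral M0 MN mg1 g10 g1b).
  - have := has_power_integral M0 MN mg g0 gb k.
    congr has_integral; apply/funext => z; congr (_ * _); apply: eq_bigr => i _.
    by rewrite /power_weight mul1r.
rewrite horner_prod; under eq_bigr => k _ do rewrite (p2E k).2.
(* Both instances contain the same constants [c1] and [N!]; comparing them yields the equality of
   the normalized ratios. *)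
have E1 := gin_integral_factor M0 MN mg1 g10 g1b.
have E := gin_integral_factor M0 MN mg g0 gb.
rewrite big_split/= prodfV.
have b0 : \prod_(k : 'I_M) (power_integral N g1 k : R) != 0 :> R.
  by apply/prodf_neq0 => k _; exact: (p2E k).1.
move: E1 E b0; set c1 := \prod_k (_ * _) => E1 E b0.
have c10 : c1 != 0.
  rewrite /c1; apply/prodf_neq0 => k _.
  by rewrite mulf_neq0 ?expf_neq0 ?pnatr_eq0 -?lt0n ?fact_gt0.
apply: (mulfI a0); rewrite mulVKf//.
apply: (mulIf c10); rewrite E.
rewrite mulrAC E1; field.
exact: b0.
Qed.

End total_count_laws.

(** * Identification of the laws *)

Section counts.
Context d (T : measurableType d).

Definition counts (Bs : seq (set T)) (s : config T) : seq nat :=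
  [seq points_in B s | B <- Bs].

Definition positional (D : nat) (ns : seq nat) : nat :=
  foldr (fun n a => (n + D * a)%N) 0%N ns.

Lemma total_count_digitsE D Bs s : total_count (digits D Bs) s = positional D (counts Bs s).
Proof.
elim: Bs => [|B Bs IH]; first by rewrite total_count_digits_nil.
by rewrite total_count_digits_cons IH.
Qed.

Lemma positional_inj D ns ms : size ns = size ms ->
  all (fun n => n < D)%N ns -> all (fun n => n < D)%N ms ->
  positional D ns = positional D ms -> ns = ms.
Proof.
elim: ns ms => [[]//|n ns IH [//|m ms]] /= [sz] /andP[nD nsD] /andP[mD msD] E.
have D0 : (0 < D)%N by exact: leq_ltn_trans nD.
have nm : n = m.
  have := congr1 (modn^~ D) E.
  by rewrite !(addnC _ (D * _)%N) !(mulnC D) !modnMDl !modn_small.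
move: E; rewrite nm => /addnI/eqP; rewrite eqn_pmul2l// => /eqP E.
by congr cons; exact: IH.
Qed.

Lemma points_in_le (B : set T) (s : config T) : (points_in B s <= points_in setT s)%N.
Proof. by apply: sub_count => x _; exact: mem_set. Qed.

(** The base exceeds both the counts of [s], which are at most [N], and the prescribed values, which
    are at most [sumn ns], so the digits can be read off. *)
Lemma counts_eq_total_count (Bs : seq (set T)) ns N s : size ns = size Bs ->
  points_in setT s = N ->
  counts Bs s = ns <->
  total_count (digits (N + sumn ns).+1 Bs) s = positional (N + sumn ns).+1 ns.
Proof.
move=> sz sN; rewrite total_count_digitsE; split=> [->//|].
apply: positional_inj; first by rewrite size_map.
  apply/allP => _ /mapP[B _ ->].
  by rewrite ltnS (leq_trans (points_in_le _ _))// sN leq_addr.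
apply/allP => n nns; rewrite ltnS (leq_trans _ (leq_addl _ _))//.
by rewrite sumnE (big_rem n)//= leq_addr.
Qed.

(** Single counting events are not stable under intersection, whereas finite conjunctions of them
    are, by concatenation; the condition on sizes lets a concatenated list of values be split
    again. *)
Definition count_cylinders : set (set (config T)) :=
  [set E | exists Bs ns, [/\ forall B, List.In B Bs -> measurable B,
    size ns = size Bs & E = [set s | counts Bs s = ns]]].

Lemma count_cylinders_setI : setI_closed count_cylinders.
Proof.
move=> _ _ [As [ns [mA sA ->]]] [Bs [ms [mB sB ->]]].
exists (As ++ Bs), (ns ++ ms); split.
- by move=> B /(List.in_app_or As Bs B)[]; [exact: mA|exact: mB].
- by rewrite !size_cat sA sB.
apply/seteqP; split => s /=; rewrite /counts map_cat.
  by move=> [-> ->].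
by move/eqP; rewrite eqseq_cat ?size_map// => /andP[/eqP -> /eqP ->].
Qed.

Lemma measurable_counts Bs ns : (forall B, List.In B Bs -> measurable B) ->
  measurable [set s : config T | counts Bs s = ns].
Proof.
elim: Bs ns => [|B Bs IH] [|n ns] mB.
- by rewrite (_ : mkset _ = setT)//; apply/seteqP; split.
- by rewrite (_ : mkset _ = set0)//; apply/seteqP; split.
- by rewrite (_ : mkset _ = set0)//; apply/seteqP; split.
rewrite (_ : mkset _ = [set s | points_in B s = n] `&` [set s | counts Bs s = ns]).
  apply: measurableI; last by apply: IH => A AB; apply: mB; right.
  apply: sub_sigma_algebra; exists B; first by apply: mB; left.
  by exists n.
by apply/seteqP; split => s /= [-> ->].
Qed.

Lemma count_cylinders_generate :
  @measurable _ (config T) = <<s count_cylinders >>.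
Proof.
apply/seteqP; split; last first.
  apply: smallest_sub; first exact: sigma_algebra_measurable.
  by move=> _ [Bs [ns [mB _ ->]]]; exact: measurable_counts.
apply: sub_sigma_algebra2 => _ [B mB [n ->]].
exists [:: B], [:: n]; split => //; first by move=> A [<-//|//].
by apply/seteqP; split => s /=; [move=> ->|case].
Qed.

Lemma measurable_fun_config d0 (T0 : measurableType d0) (Y : T0 -> config T) :
  (forall B n, measurable B -> measurable [set w | points_in B (Y w) = n]) ->
  measurable_fun setT Y.
Proof.
move=> mY; apply: (measurability (@counting_events _ T)) => //.
by move=> _ [_ [B mB [n ->]] <-]; rewrite setTI; exact: mY.
Qed.

End counts.

Lemma probability_setI1 d (T : measurableType d) (R : realType)
    (P : probability T R) (A C : set T) :
  measurable A -> measurable C -> P C = 1%E -> P (A `&` C) = P A.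
Proof.
move=> mA mC PC; apply/esym.
have := @measureDI _ _ _ P A C mA mC => ->.
rewrite [X in (X + _)%E](_ : _ = 0%E) ?add0e//.
apply/eqP; rewrite eq_le measure_ge0 andbT.
have <- : P (~` C) = 0%E by rewrite probability_setC// PC subee.
apply: le_measure; last by move=> x [].
  by apply/mem_set; exact: measurableD.
by apply/mem_set; exact: measurableC.
Qed.

Theorem theorem1p5 (R : realType) (M N : nat) (M_ge1 : (1 <= M)%N)
    (M_leN : (M <= N)%N)
    (d1 : measure_display) (T1 : measurableType d1) (P1 : probability T1 R)
    (L : {RV P1 >-> config R[i]}) (L_law : has_law P1 L (Gin N))
    (d2 : measure_display) (T2 : measurableType d2) (P2 : probability T2 R)
    (G : 'I_M -> {RV P2 >-> config R[i]})
    (G_law : forall k : 'I_M, has_law P2 (G k) (Gin_power N M k.+1))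
    (G_indep : mutually_independent G) :
  eq_in_law P1 (fun w => power_config M (L w))
            P2 (fun w => union_config (fun k : 'I_M => G k w)).
Proof.
set Y1 := fun w => power_config M (L w).
set Y2 := fun w => union_config (fun k : 'I_M => G k w).
have mY1 : measurable_fun setT Y1.
  apply: measurable_fun_config => B n mB.
  have mpow : measurable_fun setT (fun z : R[i] => z ^+ M) by exact: measurable_funXc.
  have mBM : measurable ((fun z : R[i] => z ^+ M) @^-1` B).
    by rewrite -[X in measurable X]setTI; exact: mpow.
  rewrite (_ : mkset _ = L @^-1`
      [set s | points_in ((fun z : R[i] => z ^+ M) @^-1` B) s = n]).
    rewrite -[X in measurable X]setTI; apply: (measurable_funP L) => //.
    by apply: sub_sigma_algebra; exists ((fun z : R[i] => z ^+ M) @^-1` B) => //; exists n.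
  apply/funext => w; rewrite /mkset /preimage/= /Y1 points_inE total_count_power_config.
  by rewrite points_inE.
have mY2 : measurable_fun setT Y2.
  apply: measurable_fun_config => B n mB.
  have mS : measurable_fun setT (fun w => (points_in B (Y2 w))%:R : R).
    under eq_fun => w do rewrite points_inE total_count_union_config natr_sum.
    apply: measurable_sum => k; under eq_fun do rewrite -points_inE.
    have mG : measurable_fun setT (G k) by exact: measurable_funP.
    have mP := @measurable_points_in _ _ R B mB.
    exact: (measurableT_comp mP mG).
  have := mS measurableT _ (measurable_set1 n%:R); rewrite setTI.
  congr measurable; apply/seteqP; split => w /=.
    by move=> /eqP; rewrite eqr_nat => /eqP.
  by move=> ->.
have mtot (d0 : measure_display) (T0 : measurableType d0) (Y : T0 -> config R[i])
    D Bs n : measurable_fun setT Y -> (forall B, List.In B Bs -> measurable B) ->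
    measurable [set w | total_count (digits D Bs) (Y w) = n].
  move=> mY mB; have := mY measurableT _ (@measurable_total_count_digits_eq _ _ R D Bs n mB).
  by rewrite setTI.
have totalE D Bs n : (forall B, List.In B Bs -> measurable B) ->
    P1 [set w | total_count (digits D Bs) (Y1 w) = n] =
    P2 [set w | total_count (digits D Bs) (Y2 w) = n].
  move=> mB; have E := total_count_law_eq M_ge1 M_leN L_law G_law G_indep D mB n.
  rewrite -[LHS]fineK ?fin_num_measure//; last exact: mtot.
  by rewrite E fineK// fin_num_measure//; exact: mtot.
have mT (B : set R[i]) : List.In B [:: setT] -> measurable B by move=> [<-//|//].
have totT D (s : config R[i]) : total_count (digits D [:: setT]) s = points_in setT s.
  by rewrite total_count_digits_cons total_count_digits_nil muln0 addn0.
have msize : measurable [set s : config R[i] | points_in setT s = N].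
  by apply: sub_sigma_algebra; exists setT => //; exists N.
(* Taking powers keeps the number of points, and every tuple integrated in [Gin N] has [N] entries,
   so this event has the same mass as the whole space. *)
have size1 : P1 [set w | points_in setT (Y1 w) = N] = 1%E.
  have -> : [set w | points_in setT (Y1 w) = N] = L @^-1` [set s | points_in setT s = N].
    apply/funext => w; rewrite /mkset /preimage/= /Y1 points_inE total_count_power_config.
    by rewrite points_inE.
  rewrite L_law//.
  have := L_law setT measurableT; rewrite preimage_setT probability_setT => ->.
  rewrite /Gin /unordered_law; congr (_ * integral _ _ _)%E.
  apply/seteqP; split => z //= _; rewrite points_inE total_count_seq_mset.
  by under eq_bigr do rewrite in_setT; rewrite sum1_size size_tuple.
(* The number of points is itself a statistic, with the single set [setT], so its law transfers from
   the left side; with one digit the base is immaterial, hence the 0. *)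
have size2 : P2 [set w | points_in setT (Y2 w) = N] = 1%E.
  rewrite -size1; have := totalE 0%N _ N mT.
  by under eq_set do rewrite totT; under [in RHS]eq_set do rewrite totT.
move=> E mE.
apply: (@measure_unique _ R (config R[i]) (@count_cylinders _ R[i]) (fun=> setT)
  (@count_cylinders_generate _ _) (@count_cylinders_setI _ _) _ _
  (pushforward P1 Y1) (pushforward P2 Y2)) => //.
- move=> _; exists [::], [::]; split => //.
  by apply/seteqP; split.
- by rewrite bigcup_const//; exists 0%N.
- move=> _ [Bs [ns [mB sz ->]]].
  (* Prescribing the counts and prescribing their encoding are equivalent on the almost sure event
     of having [N] points, so the two events have the same probability. *)
  have agree (d0 : measure_display) (T0 : measurableType d0)
      (P : probability T0 R) (Y : T0 -> config R[i]) : measurable_fun setT Y ->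
      P [set w | points_in setT (Y w) = N] = 1%E ->
      P [set w | counts Bs (Y w) = ns] =
      P [set w | total_count (digits (N + sumn ns).+1 Bs) (Y w) =
                 positional (N + sumn ns).+1 ns].
    move=> mY PN; have mN : measurable [set w | points_in setT (Y w) = N].
      by have := mY measurableT _ msize; rewrite setTI.
    have mC : measurable [set w | counts Bs (Y w) = ns].
      by have := mY measurableT _ (measurable_counts ns mB); rewrite setTI.
    rewrite -(probability_setI1 mC mN PN).
    rewrite -(probability_setI1 (mtot _ _ _ _ _ _ mY mB) mN PN).
    congr (P _); apply/seteqP; split => w /= [E1 sN]; split => //.
      exact/(counts_eq_total_count sz sN).
    exact/(counts_eq_total_count sz sN).
  rewrite /pushforward.
  rewrite [LHS](agree _ _ _ _ mY1 size1) [RHS](agree _ _ _ _ mY2 size2).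
  exact: totalE.
- move=> _; apply: (@le_lt_trans _ _ (P1 setT)); last by rewrite probability_setT ltry.
  exact: lexx.
Qed.
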